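(* Let $k$ be an algebraically closed field of characteristic not $2$, $P=k[x_1,\dots,x_n]$, $\mathbb A$ the affine space of $n$-tuples $\mathbf f=(f_1,\dots,f_n)$ of quadratic forms in $P$ (of dimension $n\binom{n+1}{2}$, coordinates the coefficients), and $\mathcal I=\{\mathbf f\in\mathbb A:\ f_1,\dots,f_n \text{ is a regular sequence and every nonzero element of the } k\text{-span of } f_1,\dots,f_n \text{ is irreducible in } P\}$. Then: (1) $\mathcal I$ is open in $\mathbb A$; (2) if $n\le4$, then $\mathcal I$ is empty; (3) if $n\ge5$, then $\mathcal I$ is nonempty. *)

(* Defs.v *)
From HB Require Import structures.
From mathcomp Require Import all_boot all_order all_algebra.
From mathcomp Require Import mpoly.
Set Implicit Arguments. Unset Strict Implicit. Unset Printing Implicit Defensive.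
Import GRing.Theory.
Local Open Scope ring_scope.

Section Defs.
Variables (k : fieldType) (n : nat).

Notation P := {mpoly k[n]}.

Definition is_unit (u : P) : Prop := exists v : P, u * v = 1.

Definition irreducibleP (p : P) : Prop :=
  p <> 0 /\ ~ is_unit p /\ forall a b : P, p = a * b -> is_unit a \/ is_unit b.

Definition in_ideal_first (f : 'I_n -> P) (i : nat) (g : P) : Prop :=
  exists h : 'I_n -> P, g = \sum_(j < n | (j < i)%N) h j * f j.

Definition regular_seq (f : 'I_n -> P) : Prop :=
  (forall (i : 'I_n) (g : P), in_ideal_first f i (g * f i) -> in_ideal_first f i g)
  /\ ~ in_ideal_first f n 1.

Definition span_irreducible (f : 'I_n -> P) : Prop :=
  forall c : 'I_n -> k, let g := \sum_(i < n) c i *: f i in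
    g <> 0 -> irreducibleP g.

Definition qmon : finType := {m : 'X_{1..n < 3} | mdeg (bmnm m) == 2%N}.

(* coordinates of the affine space A: coefficient of monomial m in f_i *)
Definition qcoord : finType := ('I_n * qmon)%type.

Definition forms (a : qcoord -> k) : 'I_n -> P :=
  fun i => \sum_(m : qmon) a (i, m) *: 'X_[bmnm (val m)].

Definition calI (a : qcoord -> k) : Prop :=
  regular_seq (forms a) /\ span_irreducible (forms a).

Definition zariski_closed (Z : (qcoord -> k) -> Prop) : Prop :=
  exists S : {mpoly k[#|qcoord|]} -> Prop,
    forall a : qcoord -> k,
      Z a <-> (forall p, S p -> p.@[fun j => a (enum_val j)] = 0).

Definition zariski_open (U : (qcoord -> k) -> Prop) : Prop :=
  zariski_closed (fun a => ~ U a).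

End Defs.

(* Main.v *)
Require Import Defs.
From HB Require Import structures.
From mathcomp Require Import all_boot all_order all_algebra.
From mathcomp Require Import ssrcomplements mpoly zify.
From Stdlib Require Import Classical.
Set Implicit Arguments. Unset Strict Implicit. Unset Printing Implicit Defensive.
Import GRing.Theory.
Local Open Scope ring_scope.

(** Both conditions are turned into the nonvanishing of determinants that are
    polynomial in the coefficients.

    Regularity.  The Hilbert function of [k[x]/(f_1, ..., f_n)] for a regular
    sequence of quadrics is that of [k[x]/(x_1^2, ..., x_n^2)].  Hence, choosing
    forms [e_s] indexed by squarefree monomials that span a complement of the
    ideal, the map [x^s x^(2h) |-> e_s f^h] is bijective in every degree.
    Conversely such a bijection transports the regularity of the [x_i^2] to the
    [f_i], and surjectivity in degrees at most [n + 1] implies it in all degrees.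

    Irreducibility.  A relation [sum c_i f_i = l l'] is a zero of the ideal of
    [k[c_i, z_ij]] generated by the 2x2 minors of [z] and the linear equations
    expressing [sum c_i f_i = sum z_ij x_i x_j].  By the projective
    Nullstellensatz there is no nontrivial zero iff the ideal contains all
    monomials of some degree [D], which is again a determinantal condition.  If
    this happens, comparing the growth of both sides of the spanning statement
    in large degrees forces [n(n+1)/2 > 3n - 2], that is [n >= 5].

    For [n >= 5], quadrics through the rational normal curve contain no product
    of linear forms in their span; a general point on the line joining them to
    the squares satisfies both open conditions. *)

(** Pigeonhole for dimensions, used to find a binary form in a graded ideal and later to bound the
    number of chart monomials. *)
Lemma linear_dependence (k : fieldType) (I J : finType) (C : I -> J -> k) :
  (#|J| < #|I|)%N ->
  exists u : I -> k, (exists i, u i != 0) /\ forall j, \sum_i u i * C i j = 0.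
Proof.
move=> ltJI.
pose A := \matrix_(i < #|I|, j < #|J|) C (enum_val i) (enum_val j).
have: kermx A != 0.
  rewrite kermx_eq0 /row_free; apply: contraL ltJI => /eqP <-.
  by rewrite -leqNgt rank_leq_col.
case/rowV0Pn => v /sub_kermxP vA v0; exists (fun i => v 0 (enum_rank i)); split.
  apply/existsP; apply: contraNT v0 => /existsPn /= v0; apply/eqP/rowP => i.
  by rewrite mxE; move: (v0 (enum_val i)); rewrite enum_valK negbK => /eqP.
move=> j; move/rowP/(_ (enum_rank j)): vA; rewrite !mxE => vA.
rewrite -[RHS]vA (reindex enum_rank) /=; last first.
  by exists enum_val => ? _; rewrite ?enum_valK ?enum_rankK.
by apply: eq_bigr => i _; rewrite !mxE !enum_rankK.
Qed.

(** * Projective Nullstellensatz *)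

Section Homogeneous.
Variables (k : fieldType) (n : nat).
Implicit Types (p q r u : {mpoly k[n]}).

Lemma pihomogM d e r u : u \is e.-homog ->
  pihomog mdeg d (r * u) = if (e <= d)%N then pihomog mdeg (d - e) r * u else 0.
Proof.
move=> hu; rewrite {1}[r]mpolyE mulr_suml raddf_sum /=.
have E m : pihomog mdeg d (r@_m *: 'X_[m] * u)
    = if (mdeg m + e == d)%N then r@_m *: 'X_[m] * u else 0.
  have hm : r@_m *: 'X_[m] * u \is (mdeg m + e).-homog.
    by apply: dhomogM => //; apply: dhomogZ; rewrite dhomogX.
  by case: eqP => [<-|/eqP ne]; [apply: pihomog_dE|apply: pihomog_ne0 ne hm].
rewrite (eq_bigr _ (fun m _ => E m)); case: leqP => [le_ed|lt_de].
  rewrite pihomogE mulr_suml [RHS]big_mkcond /=; apply: eq_bigr => m _.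
  by have -> : (mdeg m == d - e)%N = (mdeg m + e == d)%N by rewrite -(eqn_add2r e) subnK.
by rewrite big1 // => m _; case: eqP => // ed; rewrite -ed ltnNge leq_addl in lt_de.
Qed.

Lemma dhomog_msize_le d p : p \is d.-homog -> (msize p <= d.+1)%N.
Proof.
by move/dhomogP=> hp; rewrite msizeE; apply/bigmax_leqP_seq => m /hp ->.
Qed.

Lemma mcoeff_pihomog d p m : mdeg m = d -> (pihomog mdeg d p)@_m = p@_m.
Proof.
move=> dm; rewrite {2}[p]mpolyE pihomogE !raddf_sum /= [LHS]big_mkcond.
apply: eq_bigr => m' _; case: eqP => // ne; rewrite mcoeffZ mcoeffX.
by case: eqP => [E|_]; rewrite ?mulr0 //; rewrite E in ne.
Qed.

End Homogeneous.

(** * Graded ideals and adjunction of an element *)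

Section Ideals.
Variables (k : fieldType) (n : nat).
Local Notation P := {mpoly k[n]}.
Implicit Types (J : P -> Prop) (p q r u x y : P).

Definition ideal J :=
  [/\ J 0, forall p q, J p -> J q -> J (p + q) & forall p q, J q -> J (p * q)].

Definition graded J := forall d p, J p -> J (pihomog mdeg d p).

Definition adjoin J u : P -> Prop := fun p => exists q r, J q /\ p = q + r * u.

(** The radical of [J] contains all variables: [J] is irrelevant-primary or the unit ideal. *)
Definition nilvars J := forall i : 'I_n, exists e, J ('X_i ^+ e).

Lemma idealN J p : ideal J -> J p -> J (- p).
Proof. by case=> _ _ JM Jp; rewrite -mulN1r; apply: (JM). Qed.

Lemma idealB J p q : ideal J -> J p -> J q -> J (p - q).
Proof. by move=> Ji Jp Jq; case: (Ji) => _ JD _; apply: (JD) => //; apply: idealN. Qed.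

Lemma idealZ J c p : ideal J -> J p -> J (c *: p).
Proof. by case=> _ _ JM Jp; rewrite -mul_mpolyC; apply: (JM). Qed.

Lemma ideal_sum J (I : Type) (s : seq I) (C : pred I) (F : I -> P) :
  ideal J -> (forall i, C i -> J (F i)) -> J (\sum_(i <- s | C i) F i).
Proof. by case=> J0 JD _ JF; elim/big_ind: _. Qed.

Lemma ideal_congM J p q r u : ideal J -> J (p - q) -> J (r - u) -> J (p * r - q * u).
Proof.
move=> Ji Jpq Jru; case: (Ji) => _ JD JM.
have -> : p * r - q * u = r * (p - q) + q * (r - u).
  by rewrite !mulrBr [r * p]mulrC [r * q]mulrC addrA subrK.
by apply: (JD); apply: (JM).
Qed.

Lemma ideal_congX J p q e : ideal J -> J (p - q) -> J (p ^+ e - q ^+ e).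
Proof.
move=> Ji Jpq; elim: e => [|e IH]; first by case: Ji; rewrite !expr0 subrr.
by rewrite !exprS; apply: ideal_congM.
Qed.

Lemma ideal_cong_prod J (I : Type) (s : seq I) (F G : I -> P) : ideal J ->
  (forall i, J (F i - G i)) -> J (\prod_(i <- s) F i - \prod_(i <- s) G i).
Proof.
move=> Ji JFG; elim: s => [|i s IH]; first by case: Ji; rewrite !big_nil subrr.
by rewrite !big_cons; apply: ideal_congM.
Qed.

Lemma adjoin_ideal J u : ideal J -> ideal (adjoin J u).
Proof.
case=> J0 JD JM; split.
- by exists 0, 0; rewrite mul0r addr0.
- move=> _ _ [q [r [Jq ->]]] [q' [r' [Jq' ->]]]; exists (q + q'), (r + r').
  by split; [apply: (JD)|rewrite mulrDl addrACA].
- move=> p _ [q [r [Jq ->]]]; exists (p * q), (p * r).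
  by split; [apply: (JM)|rewrite mulrDr mulrA].
Qed.

Lemma adjoin_sub J u p : J p -> adjoin J u p.
Proof. by move=> Jp; exists p, 0; rewrite mul0r addr0. Qed.

Lemma adjoin_gen J u : ideal J -> adjoin J u u.
Proof. by case=> J0 _ _; exists 0, 1; rewrite mul1r add0r. Qed.

Lemma adjoin_mono J J' u p : (forall q, J q -> J' q) -> adjoin J u p -> adjoin J' u p.
Proof. by move=> sJ [q [r [/sJ Jq ->]]]; exists q, r. Qed.

Lemma adjoin_graded J u e : ideal J -> graded J -> u \is e.-homog -> graded (adjoin J u).
Proof.
move=> Ji Jg hu d _ [q [r [Jq ->]]]; rewrite raddfD /= (pihomogM _ _ hu).
case: ifP => _; last by rewrite addr0; apply/adjoin_sub/Jg.
by exists (pihomog mdeg d q), (pihomog mdeg (d - e) r); split=> //; apply: Jg.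
Qed.

Lemma nilvars_mono J J' : (forall q, J q -> J' q) -> nilvars J -> nilvars J'.
Proof. by move=> sJ nJ i; case: (nJ i) => e /sJ; exists e. Qed.

(** The product of [J + (u)] and [J + (w)] lies in [J + (u w)], which is [J]. *)
Lemma nilvars_adjoin_mul J u w : ideal J -> J (u * w) ->
  nilvars (adjoin J u) -> nilvars (adjoin J w) -> nilvars J.
Proof.
move=> Ji Juw nu nw i; case: (Ji) => _ JD JM.
have [e [q [r [Jq eq]]]] := nu i; have [f [q' [r' [Jq' eq']]]] := nw i.
exists (e + f)%N; rewrite exprD eq eq' mulrDr mulrDl; apply: (JD).
  apply: (JD); first by rewrite mulrC; apply: (JM).
  by apply: (JM).
rewrite mulrDl; apply: (JD); first by rewrite mulrC; apply: (JM).
by rewrite mulrACA; apply: (JM).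
Qed.

(** In a monomial of degree above [n] times the largest exponent, some variable reaches its own
    exponent [e j]. *)
Lemma nilvars_mdeg J : ideal J -> nilvars J ->
  exists D, forall m : 'X_{1..n}, (D <= mdeg m)%N -> J 'X_[m].
Proof.
move=> Ji /fin_all_exists [e Je]; case: (Ji) => _ _ JM.
pose E := \max_i e i; exists (n * E).+1 => m ltm.
have [j ltj] : exists j, (e j <= m j)%N.
  apply/existsP; apply: contraTT ltm => /existsPn lte; rewrite -leqNgt mdegE.
  rewrite -[X in (X * E)%N]card_ord -sum_nat_const; apply: leq_sum => i _.
  by apply: leq_trans (leq_bigmax i); apply: ltnW; rewrite ltnNge.
have -> : m = (m - U_(j) *+ e j + U_(j) *+ e j)%MM.
  rewrite submK //; apply/mnm_lepP => i; rewrite mulmnE mnm1E.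
  by case: eqP => [<-|_]; rewrite ?mul1n ?mul0n.
by rewrite mpolyXD -mpolyXn; apply: (JM).
Qed.

End Ideals.

Section ProjectiveNullstellensatz.
Variables (k : closedFieldType) (n : nat).
Local Notation P := {mpoly k[n]}.
Implicit Types (J : P -> Prop) (p q r u x y : P).

(** Once the degree is so large that [J + (X_i)] contains all monomials, a form is modulo [J] a
    multiple of [X_i]. Descending leaves a generating set whose size does not depend on [e]. The
    vanishing clause discards the indices where [e - mdeg b] truncates. *)
Lemma span_mod_var J (i : 'I_n) : ideal J -> graded J -> nilvars (adjoin J 'X_i) ->
  exists D, forall e p, p \is e.-homog ->
    exists c : 'X_{1..n < D} -> k,
      (forall b : 'X_{1..n < D}, (e < mdeg b)%N -> c b = 0) /\
      J (p - \sum_b c b *: ('X_i ^+ (e - mdeg b) * 'X_[b])).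
Proof.
move=> Ji Jg nJ; case: (Ji) => J0 JD JM; have Ai := adjoin_ideal 'X_i Ji.
have [D0 HD] := nilvars_mdeg Ai nJ; exists D0.+1.
have small e p : (e <= D0)%N -> p \is e.-homog ->
    exists c : 'X_{1..n < D0.+1} -> k,
      (forall b : 'X_{1..n < D0.+1}, (e < mdeg b)%N -> c b = 0) /\
      J (p - \sum_b c b *: ('X_i ^+ (e - mdeg b) * 'X_[b])).
  move=> le_e hp; exists (fun b => p@_b); split=> [b ltb|].
    by apply: dhomog_nemf_coeff hp _; rewrite neq_ltn ltb orbT.
  rewrite {1}[p](@mpolywE _ _ D0.+1); last exact: leq_trans (dhomog_msize_le hp) _.
  rewrite -sumrB big1 // => b _; case: (mdeg b =P e) => [->|/eqP ne].
    by rewrite subnn expr0 mul1r subrr.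
  by rewrite (dhomog_nemf_coeff hp ne) !scale0r subrr.
elim=> [|e IH] p hp; first exact: small.
have [le_e|lt_e] := leqP e.+1 D0; first exact: small.
have [q [r [Jq def_p]]] : adjoin J 'X_i p.
  rewrite [p]mpolyE big_seq; apply: ideal_sum => // m hm; apply: idealZ => //.
  by apply: HD; rewrite (dhomogP _ _ _ hp) // ltnW.
have hX : ('X_i : P) \is 1.-homog by rewrite dhomogX; apply/eqP; apply: mdeg1.
have [c [c0 Jc]] := IH _ (pihomogP mdeg e r).
exists c; split=> [b ltb|]; first by rewrite c0 // ltnW.
have -> : p = pihomog mdeg e.+1 q + 'X_i * pihomog mdeg e r.
  rewrite -{1}(pihomog_dE hp) {1}def_p raddfD /= (pihomogM _ _ hX) /= subn1.
  by rewrite [_ * 'X_i]mulrC.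
rewrite -addrA; apply: (JD); first exact: Jg.
rewrite (eq_bigr (fun b => 'X_i * (c b *: ('X_i ^+ (e - mdeg b) * 'X_[b])))).
  by rewrite -mulr_sumr -mulrBr; apply: (JM).
move=> b _; have [ltb|leb] := ltnP e (mdeg b); first by rewrite c0 // !scale0r mulr0.
by rewrite -scalerAr mulrA -exprS subSn.
Qed.

(** The binary form [x^e A(y/x)]. The degree [e] is a separate argument, because a drop in the
    degree of [A] records factors [x]. *)
Definition homogenize (x y : P) e (A : {poly k}) : P :=
  \sum_(s < e.+1) A`_s *: (x ^+ (e - s) * y ^+ s).

Lemma homogenizeX x y e (A : {poly k}) : (size A <= e.+1)%N ->
  homogenize x y e.+1 A = x * homogenize x y e A.
Proof.
move=> sA; rewrite /homogenize big_ord_recr /= nth_default // scale0r addr0 mulr_sumr.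
apply: eq_bigr => s _; rewrite -scalerAr mulrA -exprS subSn //.
by rewrite -ltnS.
Qed.

Lemma homogenize_factor x y e b (A : {poly k}) : (size A <= e.+1)%N ->
  homogenize x y e.+1 (A * ('X - b%:P)) = (y - b *: x) * homogenize x y e A.
Proof.
move=> sA; rewrite mulrBl -scalerAl -homogenizeX // mulrC mulrBl.
rewrite /homogenize (eq_bigr (fun s : 'I_e.+2 =>
  ('X * A)`_s *: (x ^+ (e.+1 - s) * y ^+ s)
  - b *: (A`_s *: (x ^+ (e.+1 - s) * y ^+ s)))); last first.
  by move=> s _; rewrite coefB coefCM scalerBl scalerA.
rewrite sumrB -scaler_sumr; congr (_ - _).
rewrite big_ord_recl coefXM scale0r add0r mulr_sumr; apply: eq_bigr => s _.
by rewrite coefXM /= subSS -scalerAr mulrCA -exprS.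
Qed.

(** A linear factor [u] splits off: [x] if the degree of [A] drops, else [y - b x] for a root [b].
    Induction on [e] treats [J] with the cofactor adjoined, and this combines with [J + (u)]. *)
Lemma nilvars_homogenize J (x y : P) e (A : {poly k}) : ideal J ->
  nilvars (adjoin J x) -> (forall b, nilvars (adjoin J (y - b *: x))) ->
  A != 0 -> (size A <= e.+1)%N -> J (homogenize x y e A) -> nilvars J.
Proof.
elim: e J A => [|e IH] J A Ji nx ny A0 sA JA.
  move=> i; exists 0%N; rewrite expr0; move: JA.
  rewrite /homogenize big_ord1 !expr0 mul1r => JA.
  have A00 : A`_0 != 0.
    apply: contraNneq A0 => A00; rewrite (size1_polyC sA) A00; exact/eqP.
  by rewrite -[1](scalerK A00); apply: idealZ.
have stepJ u (B : {poly k}) : nilvars (adjoin J u) -> B != 0 -> (size B <= e.+1)%N ->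
    homogenize x y e.+1 A = u * homogenize x y e B -> nilvars J.
  move=> nu B0 sB EA; apply: (@nilvars_adjoin_mul _ _ _ u (homogenize x y e B)) => //.
    by rewrite -EA.
  apply: (IH _ B) => //; first exact: adjoin_ideal.
  - by apply: nilvars_mono nx => q; apply: adjoin_mono => ?; apply: adjoin_sub.
  - by move=> b; apply: nilvars_mono (ny b) => q; apply: adjoin_mono => ?; apply: adjoin_sub.
  exact: adjoin_gen.
have [sA'|sA'] := leqP (size A) e.+1.
  exact: (stepJ x A nx A0 sA' (homogenizeX _ _ sA')).
have /closed_rootP [b /factor_theorem [B EB]] : size A != 1.
  by rewrite neq_ltn (leq_trans _ sA') ?orbT.
have B0 : B != 0 by apply: contraNneq A0 => B0; rewrite EB B0 mul0r.
have sB : (size B <= e.+1)%N.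
  by move: sA; rewrite EB size_Mmonic ?monicXsubC // size_XsubC addn2.
by apply: (stepJ (y - b *: x) B) => //; rewrite EB homogenize_factor.
Qed.

(* The graded pieces of [k[x]/J] have bounded dimension because [x_i] generates
   all but finitely many of them, so [J] contains a nonzero binary form in
   [x_i, x_j]; it splits into linear factors, and [J] would be irrelevant-primary
   if adjoining each of them made it so. *)
Lemma adjoin_line_not_nilvars J (i j : 'I_n) : ideal J -> graded J ->
  ~ nilvars J -> nilvars (adjoin J 'X_i) ->
  exists b : k, ~ nilvars (adjoin J ('X_j - b *: 'X_i)).
Proof.
move=> Ji Jg nJ ni; apply: NNPP => /not_ex_not_all nb; apply: nJ.
(* The degree equals the number of generators, so the [e + 1] binary monomials of degree [e] are
   dependent modulo [J]. *)
have [D HD] := span_mod_var Ji Jg ni; pose e := #|{: 'X_{1..n < D}}|.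
have hX l : ('X_l : P) \is 1.-homog by rewrite dhomogX; apply/eqP; apply: mdeg1.
have hs (s : 'I_e.+1) : ('X_i ^+ (e - s) * 'X_j ^+ s : P) \is e.-homog.
  have := dhomogM (dhomogMn (e - s) (hX i)) (dhomogMn s (hX j)).
  by rewrite !mul1n subnK // -ltnS.
have /fin_all_exists [c Hc] := fun s => HD _ _ (hs s).
have [|u [[s0 us0] Hu]] := @linear_dependence _ _ _ c; first by rewrite card_ord.
pose A := \poly_(s < e.+1) u (inord s).
apply: (@nilvars_homogenize J 'X_i 'X_j e A) => //.
- apply: contraNneq us0 => A0; have := congr1 (fun B : {poly k} => B`_s0) A0.
  by rewrite coef_poly ltn_ord inord_val coef0 => ->.
- exact: size_poly.
have -> : homogenize 'X_i 'X_j e A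
    = \sum_s u s *: ('X_i ^+ (e - s) * 'X_j ^+ s
        - \sum_b c s b *: ('X_i ^+ (e - mdeg b) * 'X_[b])).
  rewrite /homogenize (eq_bigr (fun s => u s *: ('X_i ^+ (e - s) * 'X_j ^+ s))).
    rewrite (eq_bigr _ (fun s _ => scalerBr _ _ _)) sumrB.
    rewrite [X in _ - X](_ : _ = 0) ?subr0 //.
    rewrite (eq_bigr (fun s => \sum_b (u s * c s b) *: ('X_i ^+ (e - mdeg b) * 'X_[b]))).
      rewrite exchange_big /= big1 // => b _.
      by rewrite -scaler_suml Hu scale0r.
    by move=> s _; rewrite scaler_sumr; apply: eq_bigr => b _; rewrite scalerA.
  by move=> s _; rewrite coef_poly ltn_ord inord_val.
by apply: ideal_sum => // s _; apply: idealZ => //; case: (Hc s).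
Qed.

(** Variables are adjoined as long as the ideal does not become irrelevant-primary. A variable that
    cannot be adjoined becomes the nonzero coordinate of the zero to be found. *)
Lemma exists_pivot J (s : seq 'I_n) : ideal J -> graded J -> ~ nilvars J ->
  exists J', [/\ ideal J', graded J', ~ nilvars J', forall p, J p -> J' p &
    (exists i, nilvars (adjoin J' 'X_i)) \/ forall i, i \in s -> J' 'X_i].
Proof.
move=> Ji Jg nJ; elim: s => [|j s [J' [Ji' Jg' nJ' sJ [H|H]]]].
- by exists J; split=> //; right.
- by exists J'; split=> //; left.
have [nj|nj] := classic (nilvars (adjoin J' 'X_j)).
  by exists J'; split=> //; left; exists j.
exists (adjoin J' 'X_j); split=> //.
- exact: adjoin_ideal.
- by apply: adjoin_graded Ji' Jg' _; rewrite dhomogX; apply/eqP/mdeg1.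
- by move=> p /sJ; apply: adjoin_sub.
right=> i; rewrite inE => /orP[/eqP->|/H]; first exact: adjoin_gen.
exact: adjoin_sub.
Qed.

(** Each step fixes the ratio of one coordinate to the pivot, until the ideal determines a
    projective point. *)
Lemma exists_lines J (i : 'I_n) (s : seq 'I_n) : ideal J -> graded J ->
  ~ nilvars J -> nilvars (adjoin J 'X_i) ->
  exists J', [/\ ideal J', ~ nilvars J', nilvars (adjoin J' 'X_i), forall p, J p -> J' p &
    graded J' /\ forall j, j \in s -> exists b : k, J' ('X_j - b *: 'X_i)].
Proof.
move=> Ji Jg nJ ni; elim: s => [|j s [J' [Ji' nJ' ni' sJ [Jg' H]]]].
  by exists J; split.
have [b nb] := adjoin_line_not_nilvars j Ji' Jg' nJ' ni'.
exists (adjoin J' ('X_j - b *: 'X_i)); split=> //.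
- exact: adjoin_ideal.
- by apply: nilvars_mono ni' => q; apply: adjoin_mono => ?; apply: adjoin_sub.
- by move=> p /sJ; apply: adjoin_sub.
split=> [|l].
  have hX h : ('X_h : P) \is 1.-homog by rewrite dhomogX; apply/eqP; apply: mdeg1.
  apply: adjoin_graded Ji' Jg' _; apply: rpredB; first exact: hX.
  by apply: rpredZ; apply: hX.
rewrite inE => /orP[/eqP->|/H [b' Hb']]; first by exists b; apply: adjoin_gen.
by exists b'; apply: adjoin_sub.
Qed.

(** Since [J2] contains all [X_j - v_j X_i], a form [p] of degree [d] is congruent to [p(v) X_i^d].
    If [p] lies in [J] and [p(v)] is nonzero, then [X_i^d] lies in [J2], and by [ni2] all variables
    are nilpotent modulo [J2], a contradiction. So [v] is a zero of [J] with [v_i = 1]. *)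
Theorem projective_nullstellensatz J : ideal J -> graded J ->
  (forall v : 'I_n -> k, (forall p, J p -> p.@[v] = 0) -> forall i, v i = 0) ->
  nilvars J.
Proof.
move=> Ji Jg HJ; apply: NNPP => nJ.
have [J1 [Ji1 Jg1 nJ1 sJ1 [[i ni]|HX]]] := exists_pivot (enum 'I_n) Ji Jg nJ; last first.
  by apply: nJ1 => i; exists 1%N; apply: HX; rewrite mem_enum.
have [J2 [Ji2 nJ2 ni2 sJ2 [Jg2 H2]]] := exists_lines (enum 'I_n) Ji1 Jg1 nJ1 ni.
have {}H2 j : exists b : k, J2 ('X_j - b *: 'X_i) by apply: H2; rewrite mem_enum.
have [b Hb] := fin_all_exists H2; case: (Ji2) => J20 JD JM.
pose v j := if j == i then 1 else b j.
have Hv j : J2 ('X_j - v j *: 'X_i).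
  by rewrite /v; case: eqP => [->|_ //]; rewrite scale1r subrr.
have eval_cong d p : p \is d.-homog -> J2 (p - p.@[v] *: 'X_i ^+ d).
  move=> hp; rewrite mevalE {1}[p]mpolyE scaler_suml -sumrB big_seq.
  apply: ideal_sum => // m hm; rewrite -scalerA -scalerBr; apply: idealZ => //.
  have -> : \prod_j v j ^+ m j *: 'X_i ^+ d = \prod_j (v j *: 'X_i) ^+ m j :> P.
    have <- : mdeg m = d := dhomogP _ _ _ hp m hm.
    rewrite mdegE -prodrXr -scaler_prod.
    by apply: eq_bigr => j _; rewrite exprZn.
  rewrite mpolyXE_id; apply: ideal_cong_prod => // j; exact: ideal_congX.
suff /HJ/(_ i)/eqP : forall p, J p -> p.@[v] = 0 by rewrite /v eqxx oner_eq0.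
move=> p Jp; rewrite [p](pihomog_partitionE (leqnn (msize p))) raddf_sum /= big1 // => d _.
apply/eqP/negPn/negP => pv0; apply: nJ2 => j.
set q := pihomog _ _ _ in pv0; have Jq : J2 q by apply/sJ2/sJ1/Jg.
have Jx : J2 ('X_i ^+ d).
  rewrite -['X_i ^+ d](scalerK pv0); apply: idealZ => //.
  rewrite -[X in J2 X](subKr q); apply: idealB => //; apply: eval_cong.
  exact: pihomogP.
have [e [q' [r [Jq' Ee]]]] := ni2 j; exists (e * d)%N.
have Jc : J2 ('X_j ^+ e - r * 'X_i) by rewrite Ee addrK.
rewrite exprM -[X in J2 X](subrK ((r * 'X_i) ^+ d)); apply: (JD).
  exact: ideal_congX.
by rewrite exprMn; apply: (JM).
Qed.

End ProjectiveNullstellensatz.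

(** * Families polynomial in parameters *)

Section MonomialMatrix.
Variables (k : fieldType) (n d : nat).

(* [mons n 2] is convertible to [qmon n]. *)
Definition mons : finType := {m : 'X_{1..n < d.+1} | mdeg (bmnm m) == d}.

Definition mon_of (m : mons) : 'X_{1..n} := bmnm (val m).

Lemma mdeg_mon_of (m : mons) : mdeg (mon_of m) = d.
Proof. exact/eqP/(valP m). Qed.

Lemma mon_of_inj : injective mon_of.
Proof. by move=> m m' E; apply/val_inj/val_inj. Qed.

Lemma mon_ofP (m : 'X_{1..n}) : mdeg m = d -> exists m' : mons, mon_of m' = m.
Proof.
move=> dm; have lt_m : (mdeg m < d.+1)%N by rewrite dm.
have dm' : mdeg (bmnm (BMultinom lt_m)) == d by apply/eqP.
by exists (exist _ (BMultinom lt_m) dm').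
Qed.

Lemma homog_mons (p : {mpoly k[n]}) : p \is d.-homog ->
  p = \sum_(m : mons) p@_(mon_of m) *: 'X_[mon_of m].
Proof.
move=> hp; apply/mpolyP => m; rewrite raddf_sum /=.
have [dm|ndm] := eqVneq (mdeg m) d; last first.
  rewrite (dhomog_nemf_coeff hp ndm) big1 // => m' _; rewrite mcoeffZ mcoeffX.
  by case: eqP => [E|]; rewrite ?mulr0 //; rewrite -E mdeg_mon_of eqxx in ndm.
have [m0 <-] := mon_ofP dm; rewrite (bigD1 m0) //= mcoeffZ mcoeffX eqxx mulr1.
rewrite big1 ?addr0 // => m' ne; rewrite mcoeffZ mcoeffX.
by rewrite (inj_eq mon_of_inj) (negbTE ne) mulr0.
Qed.

(** The family is indexed by the monomials themselves: the matrix is square, and spanning a degree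
    is the nonvanishing of one determinant. *)
Definition mon_matrix (F : mons -> {mpoly k[n]}) : 'M[k]_#|mons| :=
  \matrix_(i, j) (F (enum_val i))@_(mon_of (enum_val j)).

Lemma sum_mons (V : nmodType) (G : mons -> V) :
  \sum_(m : mons) G m = \sum_(i < #|mons|) G (enum_val i).
Proof.
rewrite [RHS](reindex enum_rank) /=.
  by apply: eq_bigr => m _; rewrite enum_rankK.
by exists enum_val => ? _; rewrite ?enum_valK ?enum_rankK.
Qed.

Lemma mon_matrix_unit (F : mons -> {mpoly k[n]}) :
  (forall m, exists c : mons -> k, 'X_[mon_of m] = \sum_m' c m' *: F m') ->
  \det (mon_matrix F) != 0.
Proof.
move=> /fin_all_exists [c Hc].
pose C := \matrix_(i < #|mons|, j < #|mons|) c (enum_val i) (enum_val j).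
have CF : C *m mon_matrix F = 1%:M.
  apply/matrixP => i j; rewrite !mxE.
  have /(congr1 (mcoeff (mon_of (enum_val j)))) := Hc (enum_val i).
  rewrite mcoeffX (inj_eq mon_of_inj) (inj_eq enum_val_inj) => ->.
  by rewrite raddf_sum /= sum_mons; apply: eq_bigr => l _; rewrite mcoeffZ !mxE.
by have := mulmx1_unit CF => -[_]; rewrite unitmxE unitfE.
Qed.

Lemma mon_matrix_span (F : mons -> {mpoly k[n]}) (p : {mpoly k[n]}) :
  (forall m, F m \is d.-homog) -> \det (mon_matrix F) != 0 -> p \is d.-homog ->
  exists c : mons -> k, p = \sum_m c m *: F m.
Proof.
move=> hF dF hp; pose v := \row_(i < #|mons|) p@_(mon_of (enum_val i)).
pose w := v *m invmx (mon_matrix F); exists (fun m => w 0 (enum_rank m)).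
have uF : mon_matrix F \in unitmx by rewrite unitmxE unitfE.
have vE : v = w *m mon_matrix F by rewrite mulmxKV.
rewrite [LHS]homog_mons //; rewrite [RHS]homog_mons; last first.
  by apply: rpred_sum => m _; apply: rpredZ; apply: hF.
apply: eq_bigr => m _; congr (_ *: _).
have /rowP/(_ (enum_rank m)) := vE; rewrite !mxE enum_rankK => ->.
rewrite raddf_sum /= sum_mons; apply: eq_bigr => i _.
by rewrite mcoeffZ !mxE enum_valK enum_rankK.
Qed.

Lemma mon_matrix_free (F : mons -> {mpoly k[n]}) (c : mons -> k) :
  \det (mon_matrix F) != 0 ->
  (forall m, \sum_m' c m' * (F m')@_(mon_of m) = 0) -> forall m, c m = 0.
Proof.
move=> dF Hc m; pose v := \row_(i < #|mons|) c (enum_val i).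
have uF : mon_matrix F \in unitmx by rewrite unitmxE unitfE.
have v0 : v *m mon_matrix F = 0.
  apply/rowP => j; rewrite !mxE -[RHS](Hc (enum_val j)) sum_mons.
  by apply: eq_bigr => i _; rewrite !mxE.
have /rowP/(_ (enum_rank m)) : v = 0 by rewrite -(mulmxK uF v) v0 mul0mx.
by rewrite !mxE enum_rankK.
Qed.

End MonomialMatrix.

Section PolynomialFamilies.
Variables (k : fieldType) (Q : finType).
Local Notation R := {mpoly k[#|Q|]}.
Implicit Types (a b : Q -> k).

(** The evaluation occurring in [zariski_closed], named so that it can carry a ring morphism
    structure. *)
Definition coord_eval a (p : R) : k := p.@[fun j => a (enum_val j)].
HB.instance Definition _ a := GRing.RMorphism.copy (coord_eval a) (coord_eval a).

Variable N : nat.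
Implicit Types (F G : (Q -> k) -> {mpoly k[N]}).

Definition polyfam F :=
  exists G : {mpoly R[N]}, forall a, F a = map_mpoly (coord_eval a) G.

Lemma polyfamC (p : {mpoly k[N]}) : polyfam (fun=> p).
Proof.
exists (map_mpoly (@mpolyC _ k) p) => a; apply/mpolyP => m.
by rewrite !mcoeff_map_mpoly /= /coord_eval mevalC.
Qed.

Lemma polyfam_coord (t : Q) : polyfam (fun a => (a t)%:MP).
Proof.
exists ('X_(enum_rank t))%:MP => a.
by rewrite map_mpolyC /= /coord_eval mevalXU enum_rankK.
Qed.

Lemma polyfamB F G : polyfam F -> polyfam G -> polyfam (fun a => F a - G a).
Proof. by move=> [f Ef] [g Eg]; exists (f - g) => a; rewrite raddfB /= Ef Eg. Qed.

Lemma polyfamM F G : polyfam F -> polyfam G -> polyfam (fun a => F a * G a).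
Proof. by move=> [f Ef] [g Eg]; exists (f * g) => a; rewrite rmorphM /= Ef Eg. Qed.

Lemma polyfamX F e : polyfam F -> polyfam (fun a => F a ^+ e).
Proof. by move=> [f Ef]; exists (f ^+ e) => a; rewrite rmorphXn /= Ef. Qed.

Lemma polyfam_sum (I : finType) (F : I -> (Q -> k) -> {mpoly k[N]}) :
  (forall i, polyfam (F i)) -> polyfam (fun a => \sum_i F i a).
Proof.
move=> /fin_all_exists [f Ef]; exists (\sum_i f i) => a.
by rewrite raddf_sum /=; apply: eq_bigr => i _.
Qed.

Lemma polyfam_prod (I : finType) (F : I -> (Q -> k) -> {mpoly k[N]}) :
  (forall i, polyfam (F i)) -> polyfam (fun a => \prod_i F i a).
Proof.
move=> /fin_all_exists [f Ef]; exists (\prod_i f i) => a.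
by rewrite rmorph_prod /=; apply: eq_bigr => i _.
Qed.

Lemma polyfam_det d (F : mons N d -> (Q -> k) -> {mpoly k[N]}) :
  (forall m, polyfam (F m)) ->
  exists p : R, forall a, coord_eval a p = \det (mon_matrix (F^~ a)).
Proof.
move=> /fin_all_exists [f Ef].
exists (\det (\matrix_(i < #|mons N d|, j < #|mons N d|)
  (f (enum_val i))@_(mon_of (enum_val j)))) => a.
rewrite -det_map_mx; congr (\det _); apply/matrixP => i j.
by rewrite !mxE Ef mcoeff_map_mpoly.
Qed.

End PolynomialFamilies.

(** * Openness of having no nontrivial common zero *)

Section OpenNoZero.
Variables (k : closedFieldType) (N : nat) (I : finType).

Lemma gen_ideal_nilvars (g : I -> {mpoly k[N]}) (deg : I -> nat) :
  (forall i, g i \is (deg i).-homog) ->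
  (forall v : 'I_N -> k, (forall i, (g i).@[v] = 0) -> forall j, v j = 0) ->
  exists D, forall m : 'X_{1..N}, (D <= mdeg m)%N ->
    exists h : I -> {mpoly k[N]}, 'X_[m] = \sum_i h i * g i.
Proof.
move=> hg Hg; pose J (p : {mpoly k[N]}) := exists h : I -> {mpoly k[N]}, p = \sum_i h i * g i.
have Ji : ideal J.
  split.
  - by exists (fun=> 0); rewrite big1 // => i _; rewrite mul0r.
  - move=> _ _ [h ->] [h' ->]; exists (fun i => h i + h' i).
    by rewrite -big_split; apply: eq_bigr => i _; rewrite mulrDl.
  - move=> p _ [h ->]; exists (fun i => p * h i).
    by rewrite mulr_sumr; apply: eq_bigr => i _; rewrite mulrA.
have Jg : graded J.
  move=> d _ [h ->].
  exists (fun i => if (deg i <= d)%N then pihomog mdeg (d - deg i) (h i) else 0).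
  rewrite raddf_sum /=; apply: eq_bigr => i _; rewrite (pihomogM _ _ (hg i)).
  by case: ifP; rewrite ?mul0r.
have /(nilvars_mdeg Ji) [D HD] : nilvars J.
  apply: projective_nullstellensatz Ji Jg _ => v Hv j; apply: Hg => i.
  apply: Hv; exists (fun i' => if i' == i then 1 else 0).
  rewrite (bigD1 i) //= eqxx mul1r big1 ?addr0 // => i' /negPf ->.
  by rewrite mul0r.
by exists D.
Qed.

Variable Q : finType.

(** At [a], the monomials of some degree [D] are combinations of the generators. Freezing the
    cofactors and varying the parameter gives forms [F m b] whose determinant is nonzero at [a].
    Wherever it is nonzero, these forms span degree [D], so every [X_j^D] lies in the ideal. *)
Lemma open_no_zero (g : I -> (Q -> k) -> {mpoly k[N]}) (deg : I -> nat) (a : Q -> k) :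
  (forall i, polyfam (g i)) -> (forall i b, g i b \is (deg i).-homog) ->
  (forall v : 'I_N -> k, (forall i, (g i a).@[v] = 0) -> forall j, v j = 0) ->
  exists p : {mpoly k[#|Q|]}, coord_eval a p != 0 /\
    forall b, coord_eval b p != 0 ->
    forall v : 'I_N -> k, (forall i, (g i b).@[v] = 0) -> forall j, v j = 0.
Proof.
move=> pg hg Hg; have [D HD] := gen_ideal_nilvars (hg^~ a) Hg.
have HD' (m : mons N D) : exists h : I -> {mpoly k[N]},
    'X_[mon_of m] = \sum_i h i * g i a by apply: HD; rewrite mdeg_mon_of.
have [h Hh] := fin_all_exists HD'.
(* Keeping only the component of complementary degree makes [F m b] homogeneous for every [b]. *)
pose h' m i := if (deg i <= D)%N then pihomog mdeg (D - deg i) (h m i) else 0.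
pose F (m : mons N D) b := \sum_i h' m i * g i b.
have hF m b : F m b \is D.-homog.
  apply: rpred_sum => i _; rewrite /h'; case: ifP => [le_i|_]; last by rewrite mul0r rpred0.
  by rewrite -(subnK le_i) addnK; apply: dhomogM => //; apply: pihomogP.
have Fa m : F m a = 'X_[mon_of m].
  have hX : ('X_[mon_of m] : {mpoly k[N]}) \is D.-homog by rewrite dhomogX; apply/eqP/mdeg_mon_of.
  rewrite -(pihomog_dE hX) [in RHS]Hh raddf_sum /=; apply: eq_bigr => i _.
  by rewrite (pihomogM _ _ (hg i a)) /h'; case: ifP; rewrite ?mul0r.
have [|p Hp] := @polyfam_det k Q N D F.
  by move=> m; apply: polyfam_sum => i; apply: polyfamM => //; apply: polyfamC.
exists p; rewrite Hp; split.
  apply: mon_matrix_unit => m; exists (fun m' => (m' == m)%:R).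
  rewrite (bigD1 m) //= eqxx scale1r Fa big1 ?addr0 // => m' /negPf ->.
  by rewrite scale0r.
move=> b; rewrite Hp => pb v Hv j.
have hX : ('X_j ^+ D : {mpoly k[N]}) \is D.-homog.
  by rewrite mpolyXn dhomogX /= mdegMn mdeg1 mul1n.
have [c Hc] := mon_matrix_span (hF^~ b) pb hX.
have : ('X_j ^+ D : {mpoly k[N]}).@[v] = 0.
  rewrite Hc raddf_sum /= big1 // => m _; rewrite mevalZ raddf_sum /= big1 ?mulr0 // => i _.
  by rewrite rmorphM /= Hv mulr0.
by rewrite rmorphXn /= mevalXU => /eqP; rewrite expf_eq0 => /andP[_ /eqP].
Qed.

End OpenNoZero.

(** * Regular sequences of quadrics *)

Section SquareSplitting.
Variable n : nat.
Implicit Types (m : 'X_{1..n}).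

Definition mnm_half m : 'X_{1..n} := [multinom (m i)./2 | i < n].
Definition mnm_odd m : 'X_{1..n} := [multinom odd (m i) : nat | i < n].

Lemma mdeg_odd_half m : mdeg m = (mdeg (mnm_odd m) + 2 * mdeg (mnm_half m))%N.
Proof.
rewrite !mdegE big_distrr -big_split /=; apply: eq_bigr => i _.
by rewrite !mnmE mul2n odd_double_half.
Qed.

Lemma mnm_oddD2 m j : mnm_odd (m + U_(j) *+ 2) = mnm_odd m.
Proof.
by apply/mnmP => i; rewrite [LHS]mnmE [RHS]mnmE mnmDE mulmnE oddD oddM andbF addbF.
Qed.

Lemma mnm_halfD2 m j : mnm_half (m + U_(j) *+ 2) = (mnm_half m + U_(j))%MM.
Proof.
apply/mnmP => i; rewrite [LHS]mnmE [RHS]mnmDE mnmDE [mnm_half m i]mnmE mulmnE mnm1E muln2.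
rewrite halfD odd_double andbF add0n.
by rewrite doubleK.
Qed.

Lemma mnm_subD2 m j : (1 < m j)%N -> m = (m - U_(j) *+ 2 + U_(j) *+ 2)%MM.
Proof.
move=> ltj; rewrite submK //; apply/mnm_lepP => i; rewrite mulmnE mnm1E.
by case: eqP => [<-|_]; rewrite ?mul0n ?mul1n.
Qed.

Lemma mdeg_exists_square m : (n < mdeg m)%N -> exists j, (1 < m j)%N.
Proof.
move=> ltn; apply/existsP; apply: contraTT ltn => /existsPn le1.
rewrite -leqNgt mdegE -[X in (_ <= X)%N]card_ord -sum1_card; apply: leq_sum => i _.
by rewrite leqNgt.
Qed.

End SquareSplitting.

Section FirstIdeal.
Variables (k : fieldType) (n : nat) (f : 'I_n -> {mpoly k[n]}).

Lemma in_ideal_first_ideal i : ideal (in_ideal_first f i).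
Proof.
split.
- by exists (fun=> 0); rewrite big1 // => j _; rewrite mul0r.
- move=> _ _ [h ->] [h' ->]; exists (fun j => h j + h' j).
  by rewrite -big_split; apply: eq_bigr => j _; rewrite mulrDl.
- move=> p _ [h ->]; exists (fun j => p * h j).
  by rewrite mulr_sumr; apply: eq_bigr => j _; rewrite mulrA.
Qed.

Lemma in_ideal_first_gen i (j : 'I_n) : (j < i)%N -> in_ideal_first f i (f j).
Proof.
move=> lt_ji; exists (fun l => (l == j)%:R); rewrite (bigD1 j) //= eqxx mul1r.
by rewrite big1 ?addr0 // => l /andP[_ /negPf->]; rewrite mul0r.
Qed.

Lemma in_ideal_first_le i i' g : (i <= i')%N ->
  in_ideal_first f i g -> in_ideal_first f i' g.
Proof.
move=> le_i [h ->]; apply: ideal_sum; first exact: in_ideal_first_ideal.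
move=> j ltj; have [_ _ JM] := in_ideal_first_ideal i'.
by apply: JM; apply: in_ideal_first_gen; apply: leq_trans ltj le_i.
Qed.

End FirstIdeal.

(* If the [e s] span a complement of the ideal of the [f i], the map
   [x^m |-> Phi m] is a linear automorphism of [k[x]] which turns
   multiplication by [x_j^2] into multiplication by [f j]. *)
Section SquareTransport.
Variables (k : fieldType) (n : nat).
Local Notation P := {mpoly k[n]}.
Variables (e : 'X_{1..n} -> P) (f : 'I_n -> P).
Hypothesis he : forall s, e s \is (mdeg s).-homog.
Hypothesis hf : forall i, f i \is 2.-homog.

Definition Phi (m : 'X_{1..n}) : P := e (mnm_odd m) * \prod_i f i ^+ mnm_half m i.

Lemma Phi_homog m : Phi m \is (mdeg m).-homog.
Proof.
rewrite mdeg_odd_half; apply: dhomogM => //.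
rewrite [mdeg (mnm_half m)]mdegE big_distrr /=.
elim/big_ind2: _ => [|p d q d' hp hq|i _]; first exact: dhomog1.
  exact: dhomogM.
exact: dhomogMn.
Qed.

Lemma PhiD2 m j : Phi (m + U_(j) *+ 2) = f j * Phi m.
Proof.
rewrite /Phi mnm_oddD2 mnm_halfD2 mulrCA; congr (_ * _).
rewrite (eq_bigr (fun i => f i ^+ (U_(j)%MM i) * f i ^+ mnm_half m i)); last first.
  by move=> i _; rewrite mnmDE addnC exprD.
rewrite big_split; congr (_ * _); rewrite (bigD1 j) //= mnm1E eqxx expr1.
rewrite big1 ?mulr1 // => i /negPf ne; rewrite mnm1E eq_sym ne; exact: expr0.
Qed.

Definition Phi_span d (p : P) := exists c : mons n d -> k, p = \sum_m c m *: Phi (mon_of m).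

Lemma Phi_span_sum d (I : Type) (s : seq I) (c : I -> k) (F : I -> P) :
  (forall i, Phi_span d (F i)) -> Phi_span d (\sum_(i <- s) c i *: F i).
Proof.
move=> HF; elim: s => [|i s [c' Hc']].
  by exists (fun=> 0); rewrite big_nil big1 // => m _; rewrite scale0r.
have [c'' Hc''] := HF i; exists (fun m => c i * c'' m + c' m).
rewrite big_cons Hc' Hc'' scaler_sumr -big_split; apply: eq_bigr => m _.
by rewrite scalerDl scalerA.
Qed.

Lemma Phi_span_Phi d m : mdeg m = d -> Phi_span d (Phi m).
Proof.
move=> dm; have [m0 <-] := mon_ofP dm; exists (fun m' => (m' == m0)%:R).
rewrite (bigD1 m0) //= eqxx scale1r big1 ?addr0 // => m' /negPf ->.
by rewrite scale0r.
Qed.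

Lemma Phi_span_mulf d j p : Phi_span d p -> Phi_span d.+2 (f j * p).
Proof.
move=> [c ->]; rewrite mulr_sumr.
rewrite (eq_bigr (fun m => c m *: Phi (mon_of m + U_(j) *+ 2))); last first.
  by move=> m _; rewrite PhiD2 -scalerAr.
apply: Phi_span_sum => m; apply: Phi_span_Phi.
by rewrite mdegD mdeg_mon_of mdegMn mdeg1 mul1n addn2.
Qed.

(** For [d > n + 1], write a monomial as [X_j] times one of degree [d - 1], and expand the latter in
    terms [Phi m]. As [d - 1 > n], each [m] contains a square, so [Phi m = f_l Phi m1], and
    [X_j Phi m1] has degree [d - 2], where induction applies. *)
Lemma Phi_span_all :
  (forall d p, (d <= n.+1)%N -> p \is d.-homog -> Phi_span d p) ->
  forall d p, p \is d.-homog -> Phi_span d p.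
Proof.
move=> small d; elim/ltn_ind: d => d IH p hp.
have [le_d|lt_d] := leqP d n.+1; first exact: small.
rewrite (homog_mons hp); apply: Phi_span_sum => m {p hp}.
have [j ltj] : exists j, (1 < mon_of m j)%N.
  by apply: mdeg_exists_square; rewrite mdeg_mon_of ltnW.
case: d IH lt_d m ltj => [|[|d]] // IH lt_d m ltj.
pose m' := (mon_of m - U_(j))%MM.
have Em : mon_of m = (U_(j) + m')%MM.
  by rewrite addmC submK // lep1mP -lt0n ltnW.
have dm' : mdeg m' = d.+1.
  by apply: succn_inj; rewrite -(mdeg_mon_of m) Em mdegD mdeg1.
have [c Hc] : Phi_span d.+1 'X_[m'] by apply: IH => //; rewrite dhomogX /= dm'.
rewrite Em mpolyXD Hc mulr_sumr.
rewrite (eq_bigr (fun i => c i *: ('X_j * Phi (mon_of i)))); last first.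
  by move=> i _; rewrite -scalerAr.
apply: Phi_span_sum => i.
have [l ltl] : exists l, (1 < mon_of i l)%N.
  by apply: mdeg_exists_square; rewrite mdeg_mon_of.
have di : (mdeg (mon_of i - U_(l) *+ 2)%MM).+1 = d.
  have := mdeg_mon_of i; rewrite {1}(mnm_subD2 ltl) mdegD mdegMn mdeg1 mul1n addn2.
  exact: succn_inj.
rewrite (mnm_subD2 ltl) PhiD2 mulrCA; apply: Phi_span_mulf; apply: IH => //.
move: (_ - _)%MM di => m1 <-; rewrite -add1n.
by apply: dhomogM; [rewrite dhomogX /= mdeg1|apply: Phi_homog].
Qed.

Definition transport (p : P) : P := \sum_(m <- msupp p) p@_m *: Phi m.

Lemma transportE b p : (msize p <= b)%N ->
  transport p = \sum_(m : 'X_{1..n < b}) p@_m *: Phi m.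
Proof.
move=> lt_pb; pose I : subFinType _ := 'X_{1..n < b}.
rewrite /transport (big_mksub I) //=; first last.
+ by move=> x /msize_mdeg_lt /leq_trans /(_ lt_pb) ->.
+ by rewrite msupp_uniq.
by rewrite big_rmcond //= => m /memN_msupp_eq0 ->; rewrite scale0r.
Qed.

Lemma transport_is_linear : linear transport.
Proof.
move=> c p q; pose b := maxn (msize (c *: p + q)) (maxn (msize p) (msize q)).
rewrite !(@transportE b) ?leq_max ?leqnn ?orbT //.
rewrite scaler_sumr -big_split; apply: eq_bigr => m _ /=.
by rewrite mcoeffD mcoeffZ scalerDl scalerA.
Qed.

HB.instance Definition _ :=
  GRing.isLinear.Build k {mpoly k[n]} {mpoly k[n]} _ transport transport_is_linear.

Lemma transportX m : transport 'X_[m] = Phi m.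
Proof. by rewrite /transport msuppX big_seq1 mcoeffX eqxx scale1r. Qed.

Lemma transport_square j p : transport ('X_[U_(j) *+ 2] * p) = f j * transport p.
Proof.
rewrite [p in LHS]mpolyE mulr_sumr linear_sum [in RHS]/transport mulr_sumr.
apply: eq_bigr => m _; rewrite -scalerAr -mpolyXD linearZ /=.
by rewrite transportX addmC PhiD2 -scalerAr.
Qed.

Lemma transport_homog d p : p \is d.-homog -> transport p \is d.-homog.
Proof.
move=> /dhomogP hp; rewrite /transport big_seq; apply: rpred_sum => m /hp /= <-.
by apply: rpredZ; apply: Phi_homog.
Qed.

Hypothesis spanP : forall d p, p \is d.-homog -> Phi_span d p.

Lemma transport_surj g : exists p, g = transport p.
Proof.
rewrite [g](pihomog_partitionE (leqnn (msize g))); elim/big_ind: _.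
- by exists 0; rewrite linear0.
- by move=> _ _ [p ->] [q ->]; exists (p + q); rewrite linearD.
move=> d _; have [c ->] := spanP (pihomogP mdeg d g).
exists (\sum_m c m *: 'X_[mon_of m]); rewrite linear_sum; apply: eq_bigr => m _.
by rewrite linearZ /= transportX.
Qed.

(** The map preserves degrees, and in each degree its matrix is square with spanning rows, hence
    invertible. *)
Lemma transport_inj p : transport p = 0 -> p = 0.
Proof.
move=> Tp; apply/mpolyP => m; rewrite mcoeff0.
have [m0 <-] := mon_ofP (erefl (mdeg m)); set d := mdeg m in m0 *.
have hT d' : transport (pihomog mdeg d' p) \is d'.-homog by apply/transport_homog/pihomogP.
have Td : transport (pihomog mdeg d p) = 0.
  rewrite -[RHS](pihomog0 _ mdeg d) -Tp.
  have le_p : (msize p <= maxn (msize p) d.+1)%N by apply: leq_maxl.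
  have -> : transport p = \sum_(i < maxn (msize p) d.+1) transport (pihomog mdeg i p).
    by rewrite -(linear_sum (transport : {linear P -> P})) -(pihomog_partitionE le_p).
  have lt_d : (d < maxn (msize p) d.+1)%N by rewrite leq_maxr.
  rewrite (linear_sum (pihomog mdeg d : {linear P -> P})) (bigD1 (Ordinal lt_d)) //=.
  rewrite (pihomog_dE (hT d)) big1 ?addr0 // => i ne.
  by apply: pihomog_ne0 (hT i); rewrite -(inj_eq val_inj) in ne.
have detF : \det (mon_matrix (fun m : mons n d => Phi (mon_of m))) != 0.
  by apply: mon_matrix_unit => m'; apply: spanP; rewrite dhomogX /= mdeg_mon_of.
apply: (mon_matrix_free (c := fun m' => p@_(mon_of m')) detF) => m'.
have E : transport (pihomog mdeg d p) = \sum_(m1 : mons n d) p@_(mon_of m1) *: Phi (mon_of m1).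
  rewrite {1}(homog_mons (pihomogP mdeg d p)) (linear_sum (transport : {linear P -> P})).
  apply: eq_bigr => m1 _; rewrite linearZ /= transportX mcoeff_pihomog //.
  exact: mdeg_mon_of.
have := congr1 (mcoeff (mon_of m')) (etrans (esym E) Td); rewrite mcoeff0.
rewrite (raddf_sum (mcoeff (mon_of m') : {additive P -> k})) => E0.
by apply: etrans E0; apply: eq_bigr => m1 _ /=; rewrite mcoeffZ.
Qed.

(** Regularity of the squares, read on monomials: [x_i^2 m] occurs on the right, so some [x_j^2]
    with [j < i] divides it, and hence divides [m]. *)
Lemma square_regular (i : 'I_n) (G : P) (H : 'I_n -> P) :
  'X_[U_(i) *+ 2] * G = \sum_(j < n | (j < i)%N) 'X_[U_(j) *+ 2] * H j ->
  forall m, m \in msupp G -> exists2 j : 'I_n, (j < i)%N & (1 < m j)%N.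
Proof.
move=> E m; rewrite mcoeff_msupp => Gm; apply: NNPP => nj; move/eqP: Gm; apply.
have := congr1 (mcoeff (U_(i) *+ 2 + m)) E; rewrite mulrC mcoeffMX => ->.
rewrite raddf_sum /= big1 // => j lt_ji; apply: memN_msupp_eq0.
rewrite mulrC (perm_mem (msuppMX _ _)); apply/mapP => -[m' _ Em]; apply: nj; exists j => //.
have := congr1 (fun m0 : 'X_{1..n} => m0 j) Em; rewrite [LHS]mnmDE [RHS]mnmDE !mulmnE !mnm1E eqxx.
have /negPf -> : i != j by rewrite -(inj_eq val_inj) neq_ltn lt_ji orbT.
by rewrite mul0n add0n mul1n => ->.
Qed.

(** Surjectivity lifts [g] and the cofactors, and injectivity lifts the relation to one among
    squares. Every monomial of the lift of [g] is then divisible by some [x_j^2] with [j < i], so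
    its image is a multiple of [f j]. The ideal is proper because the [f j] have no constant
    term. *)
Lemma transport_regular : regular_seq f.
Proof.
split=> [i g [h Eh]|[h E1]]; last first.
  have := congr1 (mcoeff 0%MM) E1; rewrite mcoeff1 eqxx raddf_sum /= big1 => [|j _].
    by move/eqP; rewrite oner_eq0.
  by rewrite rmorphM /= (dhomog_nemf_coeff (hf j)) ?mulr0 // /= mdeg0.
have [G EG] := transport_surj g; have [H EH] := fin_all_exists (fun j => transport_surj (h j)).
have /square_regular HG : 'X_[U_(i) *+ 2] * G
    = \sum_(j < n | (j < i)%N) 'X_[U_(j) *+ 2] * H j.
  apply/eqP; rewrite -subr_eq0; apply/eqP/transport_inj.
  rewrite linearB (linear_sum (transport : {linear P -> P})) /= transport_square -EG mulrC Eh.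
  apply/eqP.
  rewrite subr_eq0; apply/eqP/eq_bigr => j _.
  by rewrite transport_square -EH mulrC.
have Ji := in_ideal_first_ideal f i; case: (Ji) => _ _ JM.
rewrite EG /transport big_seq; apply: ideal_sum => // m /HG [j ltj mj].
apply: idealZ => //; rewrite (mnm_subD2 mj) PhiD2 mulrC; apply: JM.
exact: in_ideal_first_gen.
Qed.

End SquareTransport.

(** * Hilbert function of the quotient by squares of variables *)

Section SquarefreeCount.
Variable n : nat.

(** The degree [d] monomial basis of the quotient by the squares of the first [i] variables. *)
Definition sqfree_below (i d : nat) : pred (mons n d) :=
  [pred m | [forall j : 'I_n, (j < i)%N ==> (mon_of m j <= 1)%N]].
Arguments sqfree_below : clear implicits.

Lemma card_sqfree_below0 d : #|sqfree_below 0 d| = #|mons n d|.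
Proof. by apply: eq_card => m; rewrite !inE; apply/forallP. Qed.

Lemma card_sqfree_below_small i d : (d < 2)%N -> #|sqfree_below i d| = #|mons n d|.
Proof.
move=> ltd; apply: eq_card => m; rewrite !inE; apply/forallP => j; apply/implyP => _.
rewrite -ltnS; apply: leq_ltn_trans ltd; rewrite -{2}(mdeg_mon_of m) mdegE.
by rewrite (bigD1 j) //= leq_addr.
Qed.

Lemma mdeg_mnmD2 d (j : 'I_n) (m : mons n d) : mdeg (mon_of m + U_(j) *+ 2)%MM = d.+2.
Proof. by rewrite mdegD mdeg_mon_of mdegMn mdeg1 mul1n addn2. Qed.

(** The monomials lost in passing from [i] to [i + 1] are [x_i^2] times those counted in degree
    [d]. *)
Lemma card_sqfree_below_rec (i : 'I_n) d :
  (#|sqfree_below i.+1 d.+2| + #|sqfree_below i d| = #|sqfree_below i d.+2|)%N.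
Proof.
have /fin_all_exists [g Hg] (m : mons n d) : exists m' : mons n d.+2,
    mon_of m' = (mon_of m + U_(i) *+ 2)%MM by apply/mon_ofP/mdeg_mnmD2.
have g_inj : injective g.
  move=> m m' /(congr1 (@mon_of _ _)); rewrite !Hg => /addIm; exact: mon_of_inj.
rewrite -(cardID [pred m : mons n d.+2 | (mon_of m i <= 1)%N] (sqfree_below i d.+2)).
congr (_ + _)%N.
  apply: eq_card => m; rewrite !inE; apply/forallP/andP => [H|[/forallP H le1] j].
    split; last by have /implyP := H i; apply.
    by apply/forallP => j; apply/implyP => ltj; have /implyP := H j; apply; apply: ltnW.
  apply/implyP; rewrite ltnS leq_eqVlt => /orP[/eqP/val_inj -> //|ltj].
  by have /implyP := H j; apply.
rewrite -(card_image g_inj); apply: eq_card => m; rewrite !inE.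
apply/imageP/andP => [[m0 /forallP H ->]|[gt1 /forallP H]].
  split; first by rewrite Hg mnmDE mulmnE mnm1E eqxx mul1n addn2.
  apply/forallP => j; apply/implyP => ltj; have /implyP/(_ ltj) := H j.
  rewrite Hg mnmDE mulmnE mnm1E.
  have /negPf -> : i != j by rewrite -(inj_eq val_inj) neq_ltn ltj orbT.
  by rewrite mul0n addn0.
rewrite -ltnNge in gt1.
have [|m0 Em0] := @mon_ofP n d (mon_of m - U_(i) *+ 2).
  have := mdeg_mon_of m; rewrite {1}(mnm_subD2 gt1) mdegD mdegMn mdeg1 mul1n addn2.
  by case.
exists m0; last by apply: mon_of_inj; rewrite Hg Em0 -mnm_subD2.
rewrite !inE; apply/forallP => j; apply/implyP => ltj; have /implyP/(_ ltj) := H j.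
by rewrite Em0 mnmBE; apply: leq_trans; apply: leq_subr.
Qed.

End SquarefreeCount.

Arguments sqfree_below : clear implicits.

Lemma card_mons n d : #|mons n.+1 d| = 'C(d + n, d).
Proof.
rewrite -size_basis cardE -(size_map (@mon_of n.+1 d)); apply: perm_size; apply: uniq_perm.
- by rewrite map_inj_uniq ?enum_uniq //; apply: mon_of_inj.
- exact: uniq_basis.
move=> m; rewrite -basis_cover; apply/mapP/eqP => [[m0 _ ->]|dm].
  exact: mdeg_mon_of.
by have [m0 <-] := mon_ofP dm; exists m0; rewrite ?mem_enum.
Qed.

(** * Hilbert function of a regular sequence of quadrics *)

Section RegularDimension.
Variables (k : fieldType) (n' : nat).
Local Notation n := n'.+1.
Local Notation P := {mpoly k[n]}.
Variable f : 'I_n -> P.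
Hypothesis hf : forall i, f i \is 2.-homog.
Hypothesis f_reg : regular_seq f.
Local Notation H d := (dhomog n k d).

Lemma dim_dhomog d : \dim {: H d} = #|mons n d|.
Proof. by rewrite card_mons dimvf. Qed.

Lemma in_ideal_firstS (i : 'I_n) g :
  in_ideal_first f i.+1 g <-> adjoin (in_ideal_first f i) (f i) g.
Proof.
split=> [[h ->]|[q [r [Iq ->]]]].
  exists (\sum_(j < n | (j < i)%N) h j * f j), (h i); split; first by exists h.
  rewrite (bigD1 i) //= addrC; congr (_ + _); apply: eq_bigl => j.
  by rewrite ltnS ltn_neqAle andbC.
have [_ ID IM] := in_ideal_first_ideal f i.+1; apply: ID.
  exact: in_ideal_first_le Iq.
by apply: IM; apply: in_ideal_first_gen.
Qed.

Lemma in_ideal_first_graded i : graded (in_ideal_first f i).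
Proof.
move=> d _ [h ->].
exists (fun j => if (2 <= d)%N then pihomog mdeg (d - 2) (h j) else 0).
rewrite (linear_sum (pihomog mdeg d : {linear P -> P})) /=; apply: eq_bigr => j _.
by rewrite (pihomogM _ _ (hf j)); case: ifP; rewrite ?mul0r.
Qed.

Lemma in_ideal_first_homog i d g : g \is d.+2.-homog -> in_ideal_first f i g ->
  exists2 h : 'I_n -> P, (forall j, h j \is d.-homog)
    & g = \sum_(j < n | (j < i)%N) h j * f j.
Proof.
move=> hg [h Eh]; exists (fun j => pihomog mdeg d (h j)) => [j|]; first exact: pihomogP.
rewrite -(pihomog_dE hg) Eh (linear_sum (pihomog mdeg d.+2 : {linear P -> P})) /=.
by apply: eq_bigr => j _; rewrite (pihomogM _ _ (hf j)) /= subn2.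
Qed.

Lemma in_ideal_first_homog_small i d g : (d < 2)%N -> g \is d.-homog ->
  in_ideal_first f i g -> g = 0.
Proof.
move=> ltd hg [h Eh]; rewrite -(pihomog_dE hg) Eh.
rewrite (linear_sum (pihomog mdeg d : {linear P -> P})) /= big1 // => j _.
by rewrite (pihomogM _ _ (hf j)) leqNgt ltd.
Qed.

(** If [f i] vanished, regularity applied to [g = 1] would put 1 into the ideal. *)
Lemma regular_neq0 i : f i != 0.
Proof.
apply/eqP => fi0; case: f_reg => reg; apply.
apply: (in_ideal_first_le (ltnW (ltn_ord i))); apply: reg.
by rewrite fi0 mulr0; case: (in_ideal_first_ideal f i).
Qed.

Lemma mulf_homog j d (p : H d) : val p * f j \is d.+2.-homog.
Proof. by rewrite -addn2; apply: dhomogM (dhomog_is_dhomog p) (hf j). Qed.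

Definition mulf j d (p : H d) : H d.+2 := DHomog (mulf_homog j p).

Lemma mulf_is_linear j d : linear (@mulf j d).
Proof. by move=> c p q; apply: val_inj; rewrite /= mulrDl scalerAl. Qed.

HB.instance Definition _ j d :=
  GRing.isLinear.Build k (H d) (H d.+2) _ (@mulf j d) (@mulf_is_linear j d).

Definition mulf_lfun j d : 'Hom(H d, H d.+2) := linfun (@mulf j d).

Lemma mulf_lfunE j d (p : H d) : val (mulf_lfun j d p) = val p * f j.
Proof. by rewrite lfunE. Qed.

Lemma lker_mulf j d : lker (mulf_lfun j d) = 0%VS.
Proof.
apply/eqP; rewrite -subv0; apply/subvP => p; rewrite memv_ker memv0 => /eqP p0.
have := mulf_lfunE j p; rewrite p0 /= => /esym/eqP; rewrite mulf_eq0.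
by rewrite (negPf (regular_neq0 j)) orbF => /eqP E; apply/eqP/val_inj.
Qed.

Definition gen_space j d : {vspace H d} :=
  if d is d'.+2 then limg (mulf_lfun j d') else 0%VS.

(** The degree [d] part of [in_ideal_first f i] as a vector space, for [i] at most [n]. The
    recursion runs over natural numbers, whence [inord]. *)
Fixpoint ideal_space i d : {vspace H d} :=
  if i is i'.+1 then (ideal_space i' d + gen_space (inord i') d)%VS else 0%VS.

Lemma mem_gen_space j d (p : H d) : p \in gen_space j d ->
  exists r : P, val p = r * f j.
Proof.
case: d p => [|[|d]] p /=; rewrite ?memv0.
- by move=> /eqP ->; exists 0; rewrite mul0r.
- by move=> /eqP ->; exists 0; rewrite mul0r.
by move=> /memv_imgP [r _ ->]; exists (val r); rewrite mulf_lfunE.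
Qed.

Lemma gen_space_mem j d (p : H d) (r : P) :
  val p = pihomog mdeg d (r * f j) -> p \in gen_space j d.
Proof.
case: d p => [|[|d]] p /= Ep; move: (Ep); rewrite (pihomogM _ _ (hf j)) /= => E.
- by rewrite memv0; apply/eqP/val_inj.
- by rewrite memv0; apply/eqP/val_inj.
have -> : p = mulf_lfun j d (DHomog (pihomogP mdeg d r)).
  by apply: val_inj; rewrite mulf_lfunE /= E subn2.
by apply: memv_img; apply: memvf.
Qed.

Lemma mem_ideal_space i d (p : H d) : (i <= n)%N ->
  p \in ideal_space i d <-> in_ideal_first f i (val p).
Proof.
elim: i p => [|i IH] p lt_i /=.
  rewrite memv0; split=> [/eqP ->|[h]]; first by case: (in_ideal_first_ideal f 0).
  by rewrite big_pred0 // => p0; apply/eqP/val_inj.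
have Ei : nat_of_ord (inord i : 'I_n) = i by rewrite inordK.
have := in_ideal_firstS (inord i) (val p); rewrite Ei => ->.
split=> [/memv_addP [q /(IH _ (ltnW lt_i)) Iq [r /mem_gen_space [r' Er] ->]]|].
  by exists (val q), r'; split=> //=; rewrite -Er.
move=> [q [r [Iq Ep]]].
have Eq : val p = pihomog mdeg d q + pihomog mdeg d (r * f (inord i)).
  by rewrite -pihomogD -Ep (pihomog_dE (dhomog_is_dhomog p)).
pose q' : H d := DHomog (pihomogP mdeg d q).
pose r' : H d := DHomog (pihomogP mdeg d (r * f (inord i))).
have -> : p = q' + r' by apply: val_inj.
apply: memv_add; last exact: (gen_space_mem (r := r)).
by apply/(IH _ (ltnW lt_i)); apply: in_ideal_first_graded.
Qed.

(** Regularity says that the ideal of the first [i] elements meets the multiples of [f i] exactly in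
    [f i] times that ideal. Multiplication by [f i] is injective, so the dimension formula for a sum
    applies. *)
Lemma dim_ideal_spaceS (i : 'I_n) d :
  (\dim (ideal_space i.+1 d.+2) + \dim (ideal_space i d)
     = \dim (ideal_space i d.+2) + #|mons n d|)%N.
Proof.
have Ei : inord i = i :> 'I_n by rewrite inord_val.
have lei : (i <= n)%N by apply: ltnW.
have dimg (U : {vspace H d}) : \dim (mulf_lfun i d @: U)%VS = \dim U.
  by rewrite -(limg_ker_dim (mulf_lfun i d) U) lker_mulf capv0 dimv0.
have Ecap : (ideal_space i d.+2 :&: limg (mulf_lfun i d))%VS
    = (mulf_lfun i d @: ideal_space i d)%VS.
  apply/eqP; rewrite eqEsubv; apply/andP; split; apply/subvP => p.
    rewrite memv_cap => /andP[/(mem_ideal_space _ lei) Ip /memv_imgP [r _ Er]].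
    rewrite Er; apply: memv_img; apply/(mem_ideal_space _ lei).
    by case: f_reg => reg _; apply: reg; rewrite -mulf_lfunE -Er.
  move=> /memv_imgP [r /(mem_ideal_space _ lei) Ir ->].
  rewrite memv_cap memv_img ?memvf // andbT; apply/(mem_ideal_space _ lei).
  rewrite mulf_lfunE mulrC; have [_ _ IM] := in_ideal_first_ideal f i.
  exact: IM.
by rewrite -[\dim (ideal_space i d)]dimg -Ecap /= Ei dimv_sum_cap dimg dim_dhomog.
Qed.

Lemma dim_ideal_space_small i d : (d < 2)%N -> \dim (ideal_space i d) = 0%N.
Proof.
by case: d => [|[|//]] _; elim: i => [|i IH]; rewrite /= ?dimv0 // addv0.
Qed.

(** The codimension satisfies the same recursion and initial values as the count of squarefree
    monomials. *)
Lemma dim_ideal_space i d : (i <= n)%N ->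
  (\dim (ideal_space i d) + #|sqfree_below n i d| = #|mons n d|)%N.
Proof.
elim: i d => [|i IH] d lti; first by rewrite dimv0 card_sqfree_below0.
case: d => [|[|d]].
- by rewrite dim_ideal_space_small // card_sqfree_below_small.
- by rewrite dim_ideal_space_small // card_sqfree_below_small.
have := dim_ideal_spaceS (Ordinal lti) d.
have := card_sqfree_below_rec (Ordinal lti) d.
have := IH d (ltnW lti); have := IH d.+2 (ltnW lti).
move=> /=; lia.
Qed.

Definition sqfree_mons d : seq 'X_{1..n} := [seq mon_of m | m in sqfree_below n n d].

Lemma sqfree_mons_uniq d : uniq (sqfree_mons d).
Proof. by rewrite map_inj_uniq ?enum_uniq //; apply: mon_of_inj. Qed.

(** Matches the squarefree monomials of a degree, in their listed order, with a basis of a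
    complement of the ideal. *)
Definition complement_elt (s : 'X_{1..n}) : P :=
  val (nth 0 (vbasis (ideal_space n (mdeg s))^C) (index s (sqfree_mons (mdeg s)))).

(** A form is an ideal part plus a complement part. The ideal part has cofactors of degree [d - 2],
    covered by induction; the complement part is a combination of [Phi s] with [s] squarefree. *)
Lemma regular_spans : exists e : 'X_{1..n} -> P, (forall s, e s \is (mdeg s).-homog) /\
  forall d p, p \is d.-homog -> Phi_span e f d p.
Proof.
exists complement_elt; split=> [s|d]; first exact: dhomog_is_dhomog.
elim/ltn_ind: d => d IH p hp.
have span0 c q p1 : Phi_span complement_elt f d p1 -> Phi_span complement_elt f d q ->
    Phi_span complement_elt f d (c *: p1 + q).
  move=> [c1 ->] [c2 ->]; exists (fun m => c * c1 m + c2 m).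
  rewrite scaler_sumr -big_split; apply: eq_bigr => m _.
  by rewrite scalerDl scalerA.
have span00 : Phi_span complement_elt f d 0.
  by exists (fun=> 0); rewrite big1 // => m _; rewrite scale0r.
have span_sum (I : Type) (s : seq I) (C : pred I) (F : I -> P) :
    (forall i, C i -> Phi_span complement_elt f d (F i)) ->
    Phi_span complement_elt f d (\sum_(i <- s | C i) F i).
  move=> HF; elim/big_ind: _ => // x y Hx Hy; rewrite -[x]scale1r; exact: span0.
set V := ideal_space n d.
have /memv_addP [q Vq [c Cc Ep]] : (DHomog hp : H d) \in (V + V^C)%VS.
  by rewrite addv_complf memvf.
have -> : p = val q + val c by have := congr1 val Ep.
rewrite -[val q]scale1r; apply: (span0).
  have Iq : in_ideal_first f n (val q) by apply/(mem_ideal_space _ (leqnn n)).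
  have hq := dhomog_is_dhomog q; move: (val q) Iq hq => g Ig hg.
  have [ltd|led] := ltnP d 2; first by rewrite (in_ideal_first_homog_small ltd hg Ig).
  move: span_sum IH hg; rewrite -(subnK led) addn2 => span_sum IH hg.
  have [h hh ->] := in_ideal_first_homog hg Ig.
  by apply: span_sum => j _; rewrite mulrC; apply: Phi_span_mulf; apply: IH.
rewrite (coord_vbasis Cc) raddf_sum /=; apply: span_sum => i _.
rewrite -[_ *: _]addr0; apply: (span0) => //.
have size_sq : size (sqfree_mons d) = \dim V^C.
  rewrite size_map -cardE dimv_compl dim_dhomog.
  by have := dim_ideal_space d (leqnn n); rewrite -/V; lia.
set s := nth 0%MM (sqfree_mons d) i.
have ltsi : (i < size (sqfree_mons d))%N by rewrite size_sq.
have /mapP [m sm Es] : s \in sqfree_mons d by apply: mem_nth.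
have ds : mdeg s = d by rewrite Es mdeg_mon_of.
have -> : (vbasis V^C)`_i = complement_elt s :> P.
  by rewrite /complement_elt ds index_uniq ?sqfree_mons_uniq.
have s1 j : (s j <= 1)%N.
  move: sm; rewrite mem_enum inE => /forallP/(_ j)/implyP/(_ (ltn_ord j)).
  by rewrite -Es.
have -> : complement_elt s = Phi complement_elt f s.
  have Eo : mnm_odd s = s.
    by apply/mnmP => j; rewrite mnmE; case: (s j) (s1 j) => [|[]].
  rewrite /Phi Eo big1 ?mulr1 // => j _; rewrite mnmE.
  by case: (s j) (s1 j) => [|[]].
exact: Phi_span_Phi.
Qed.

End RegularDimension.

(** * Reducible members of the span *)

Section Forms.
Variables (k : fieldType) (n : nat).
Local Notation P := {mpoly k[n]}.
Implicit Types (a b : qcoord n -> k).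

Lemma forms_homog a i : forms a i \is 2.-homog.
Proof.
apply: rpred_sum => m _; apply: rpredZ; rewrite dhomogX; exact: (valP m).
Qed.

Lemma forms_polyfam i : polyfam (fun a => forms a i).
Proof.
apply: polyfam_sum => m.
suff [G HG] : polyfam (fun a => (a (i, m))%:MP * 'X_[bmnm (val m)] : P).
  by exists G => a; rewrite -HG mul_mpolyC.
by apply: polyfamM; [apply: polyfam_coord|apply: polyfamC].
Qed.

Lemma mcoeff_forms a i (mu : mons n 2) : (forms a i)@_(mon_of mu) = a (i, mu).
Proof.
rewrite raddf_sum /= (bigD1 mu) //= mcoeffZ mcoeffX eqxx mulr1 big1 ?addr0 // => m ne.
by rewrite mcoeffZ mcoeffX (inj_eq (@mon_of_inj n 2)) (negPf ne) mulr0.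
Qed.

(** The forms [e s] stay fixed while the quadrics vary. The determinants of the [Phi] family in
    degrees up to [n + 1] are polynomial in the coefficients, and by [Phi_span_all] their
    nonvanishing gives spanning in all degrees. *)
Lemma spans_regular_open (e : 'X_{1..n} -> P) a :
  (forall s, e s \is (mdeg s).-homog) ->
  (forall d p, p \is d.-homog -> Phi_span e (forms a) d p) ->
  exists p : {mpoly k[#|qcoord n|]}, coord_eval a p != 0 /\
    forall b, coord_eval b p != 0 -> regular_seq (forms b).
Proof.
move=> he Ha.
have /fin_all_exists [p Hp] (d : 'I_n.+2) : exists p : {mpoly k[#|qcoord n|]},
    forall b, coord_eval b p
      = \det (mon_matrix (fun m : mons n d => Phi e (forms b) (mon_of m))).
  apply: (polyfam_det (F := fun m b => Phi e (forms b) (mon_of m))) => m.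
  apply: polyfamM; first exact: polyfamC.
  by apply: polyfam_prod => i; apply: polyfamX; apply: forms_polyfam.
exists (\prod_d p d); split=> [|b].
  rewrite rmorph_prod; apply/prodf_neq0 => d _; rewrite /= Hp.
  by apply: mon_matrix_unit => m; apply: Ha; rewrite dhomogX /= mdeg_mon_of.
rewrite rmorph_prod /= => /prodf_neq0 Hb; apply: (transport_regular he (forms_homog b)).
apply: (Phi_span_all he (forms_homog b)) => d q led hq.
have ltd : (d < n.+2)%N by [].
have := Hb (Ordinal ltd) isT; rewrite Hp /= => det0.
apply: mon_matrix_span det0 hq => m; rewrite -{2}(mdeg_mon_of m).
exact: Phi_homog (forms_homog b) _.
Qed.

Definition linform (l : 'I_n -> k) : P := \sum_i l i *: 'X_i.

Lemma linform_homog l : linform l \is 1.-homog.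
Proof. by apply: rpred_sum => i _; apply: rpredZ; rewrite dhomogX /= mdeg1. Qed.

Lemma mcoeff_linform l i : (linform l)@_U_(i) = l i.
Proof.
rewrite raddf_sum /= (bigD1 i) //= mcoeffZ mcoeffXU eqxx mulr1 big1 ?addr0 // => j ne.
by rewrite mcoeffZ mcoeffXU (negPf ne) mulr0.
Qed.

Lemma linform_eq0 l : linform l = 0 -> forall i, l i = 0.
Proof. by move=> l0 i; rewrite -mcoeff_linform l0 mcoeff0. Qed.

Lemma homog1_linform (p : P) : p \is 1.-homog -> p = linform (fun i => p@_U_(i)).
Proof.
move=> hp; apply/mpolyP => m; have [dm|ndm] := eqVneq (mdeg m) 1%N; last first.
  by rewrite (dhomog_nemf_coeff hp ndm) (dhomog_nemf_coeff (linform_homog _) ndm).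
have /mdeg1P [i /eqP ->] : mdeg m == 1%N by apply/eqP.
by rewrite mcoeff_linform.
Qed.

Lemma mcoeff_linformM l l' (mu : 'X_{1..n}) :
  (linform l * linform l')@_mu
    = \sum_(t : 'I_n * 'I_n | (U_(t.1) + U_(t.2))%MM == mu) l t.1 * l' t.2.
Proof.
rewrite mulr_suml raddf_sum /= [RHS]big_mkcond.
rewrite -(pair_bigA _ (fun i j => if (U_(i) + U_(j))%MM == mu then l i * l' j else 0)) /=.
apply: eq_bigr => i _; rewrite mulr_sumr raddf_sum /=; apply: eq_bigr => j _.
rewrite -scalerAl -scalerAr -mpolyXD !mcoeffZ mcoeffX mulrA.
by case: eqP; rewrite ?mulr1 ?mulr0.
Qed.

Lemma comb_forms_homog a (c : 'I_n -> k) : \sum_i c i *: forms a i \is 2.-homog.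
Proof. by apply: rpred_sum => i _; apply: rpredZ; apply: forms_homog. Qed.

Lemma comb_forms_linformM a (c l l' : 'I_n -> k) :
  (forall mu : mons n 2, \sum_i a (i, mu) * c i
     = \sum_(t : 'I_n * 'I_n | (U_(t.1) + U_(t.2))%MM == mon_of mu) l t.1 * l' t.2) <->
  \sum_i c i *: forms a i = linform l * linform l'.
Proof.
have E mu : (\sum_i c i *: forms a i)@_(mon_of mu) = \sum_i a (i, mu) * c i.
  by rewrite raddf_sum /=; apply: eq_bigr => i _; rewrite mcoeffZ mcoeff_forms mulrC.
split=> [H|H mu]; last by rewrite -E H mcoeff_linformM.
have hll : linform l * linform l' \is 2.-homog.
  exact: (dhomogM (linform_homog l) (linform_homog l')).
rewrite (homog_mons (comb_forms_homog a c)) (homog_mons hll).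
by apply: eq_bigr => mu _; rewrite E H mcoeff_linformM.
Qed.

Lemma homog_not_unit d (p : P) : p \is d.+1.-homog -> ~ is_unit p.
Proof.
move=> hp [q E]; have := congr1 (mcoeff 0%MM) E; rewrite rmorphM /=.
rewrite (dhomog_nemf_coeff hp) /= ?mdeg0 // mul0r mcoeff1 eqxx => /esym/eqP.
by rewrite oner_eq0.
Qed.

Lemma quadric_factor (g A B : P) : g \is 2.-homog -> g <> 0 -> g = A * B ->
  ~ is_unit A -> ~ is_unit B -> exists l l', g = linform l * linform l'.
Proof.
move=> hg /eqP g0 E nA nB.
have A0 : A != 0 by apply: contraNneq g0 => A0; rewrite E A0 mul0r.
have B0 : B != 0 by apply: contraNneq g0 => B0; rewrite E B0 mulr0.
have unit1 (p : P) : msize p = 1%N -> is_unit p.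
  move=> /eqP/msize_poly1P [c c0 ->]; exists (c^-1)%:MP.
  by rewrite -mpolyCM divff.
(* [msize] is the degree plus one. *)
have sg : msize (A * B) = 3%N.
  rewrite -E; apply/eqP; rewrite eqn_leq (dhomog_msize_le hg) /= ltnNge.
  apply/negP => le2; move/negP: g0; apply; apply/eqP/mpolyP => m; rewrite mcoeff0.
  have [dm|ndm] := eqVneq (mdeg m) 2%N; last exact: dhomog_nemf_coeff hg ndm.
  by apply/memN_msupp_eq0/msize_mdeg_ge; rewrite dm.
rewrite msizeM // in sg.
have sA1 : msize A != 1%N by apply/eqP => /unit1.
have sB1 : msize B != 1%N by apply/eqP => /unit1.
have sA0 : msize A != 0%N by rewrite msize_poly_eq0.
have sB0 : msize B != 0%N by rewrite msize_poly_eq0.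
have sA : (msize A <= 2)%N by move: (msize A) (msize B) sg sA1 sB1 sA0 sB0 => x y; lia.
have sB : (msize B <= 2)%N by move: (msize A) (msize B) sg sA1 sB1 sA0 sB0 => x y; lia.
pose pi d : P -> P := pihomog mdeg d.
exists (fun i => (pi 1%N A)@_U_(i)), (fun i => (pi 1%N B)@_U_(i)).
rewrite -!homog1_linform; try exact: pihomogP.
have dec (p : P) : (msize p <= 2)%N -> p = pi 0%N p + pi 1%N p.
  by move=> sp; rewrite {1}(pihomog_partitionE sp) !big_ord_recl big_ord0 addr0.
have p0 (p : P) : exists c : k, pi 0%N p = c%:MP.
  exists ((pi 0%N p)@_0%MM); apply: msize1_polyC; apply: dhomog_msize_le.
  exact: pihomogP.
have [[cA EA] [cB EB]] := (p0 A, p0 B).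
have hA := pihomogP mdeg 1 A; have hB := pihomogP mdeg 1 B.
apply/mpolyP => m; have [dm|ndm] := eqVneq (mdeg m) 2%N; last first.
  by rewrite (dhomog_nemf_coeff hg ndm) (dhomog_nemf_coeff (dhomogM hA hB) ndm).
rewrite E [A in LHS](dec A sA) [B in LHS](dec B sB) EA EB mulrDr !mulrDl -mpolyCM !mcoeffD.
rewrite [_ * cB%:MP]mulrC !mul_mpolyC !mcoeffZ mcoeffC.
have ne1 : mdeg m != 1%N by rewrite dm.
rewrite (dhomog_nemf_coeff hA ne1) (dhomog_nemf_coeff hB ne1) !mulr0 !add0r addr0.
have /negPf -> : m != 0%MM by rewrite -mdeg_eq0 dm.
by rewrite mulr0n mulr0 add0r.
Qed.

End Forms.

(** At the last index [i] with [c i] nonzero, [f i] lies in the ideal of its predecessors, and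
    regularity with [g = 1] makes that ideal the unit ideal. The induction runs down from the last
    index. *)
Lemma regular_linear_independent (k : fieldType) (n : nat) (f : 'I_n -> {mpoly k[n]})
    (c : 'I_n -> k) : regular_seq f -> \sum_i c i *: f i = 0 -> forall i, c i = 0.
Proof.
move=> [reg n1] Hc.
suff H d : forall i : 'I_n, (n - i <= d)%N -> c i = 0 by move=> i; apply: (H n); apply: leq_subr.
elim: d => [|d IH] i led; first by move: led (ltn_ord i); lia.
apply/eqP/negPn/negP => ci; apply: n1.
apply: (in_ideal_first_le (ltnW (ltn_ord i))); apply: reg; rewrite mul1r.
exists (fun j => (- (c i)^-1 * c j)%:MP).
move: Hc; rewrite (bigID (fun j : 'I_n => (j < i)%N)) /=.
rewrite [X in _ + X](bigD1 i) ?ltnn //= [X in _ + (_ + X)]big1 => [|j /andP[gej ne]]; last first.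
  rewrite IH ?scale0r //; rewrite -leqNgt in gej.
  have : (i < j)%N by rewrite ltn_neqAle gej andbT -(inj_eq val_inj) eq_sym in ne *.
  by move: led (ltn_ord j); lia.
rewrite addr0 => /eqP; rewrite addrC addr_eq0 => /eqP E.
rewrite -[f i](scalerK ci) E scalerN scaler_sumr -sumrN; apply: eq_bigr => j _.
by rewrite mul_mpolyC scalerA mulNr scaleNr.
Qed.

(* [k[c_i, z_ij]] modulo the 2x2 minors of [z]: a projective point with
   [z = l l'^T] killing the [quadric_eqn]s is a relation [sum c_i f_i = l l']. *)
Section ReducibilityIdeal.
Variables (k : fieldType) (n : nat).

Definition cz_var : finType := ('I_n + 'I_n * 'I_n)%type.
Local Notation S := {mpoly k[#|cz_var|]}.
Implicit Types (a b : qcoord n -> k) (v : 'I_#|cz_var| -> k).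

Definition cvar (i : 'I_n) : S := 'X_(enum_rank (inl i : cz_var)).
Definition zvar (i j : 'I_n) : S := 'X_(enum_rank (inr (i, j) : cz_var)).
Definition cval v (i : 'I_n) : k := v (enum_rank (inl i : cz_var)).
Definition zval v (i j : 'I_n) : k := v (enum_rank (inr (i, j) : cz_var)).

(** The coefficient of [mu] in [sum c_i f_i - sum z_ij x_i x_j]. *)
Definition quadric_eqn a (mu : mons n 2) : S :=
  \sum_i (a (i, mu))%:MP * cvar i
  - \sum_(t : 'I_n * 'I_n) ((U_(t.1) + U_(t.2))%MM == mon_of mu)%:R%:MP * zvar t.1 t.2.

Definition minor (s t : 'I_n * 'I_n) : S :=
  zvar s.1 s.2 * zvar t.1 t.2 - zvar s.1 t.2 * zvar t.1 s.2.

Definition red_index : finType :=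
  (mons n 2 + ('I_n * 'I_n) * ('I_n * 'I_n))%type.

Definition red_gen (t : red_index) a : S :=
  match t with inl mu => quadric_eqn a mu | inr st => minor st.1 st.2 end.

Definition red_deg (t : red_index) : nat := if t is inl _ then 1 else 2.

Definition only_trivial_zero a :=
  forall v, (forall t, (red_gen t a).@[v] = 0) -> forall j, v j = 0.

Lemma var_homog j : ('X_j : S) \is 1.-homog.
Proof. by rewrite dhomogX /= mdeg1. Qed.

Lemma mulCX_homog c j : c%:MP * ('X_j : S) \is 1.-homog.
Proof. by rewrite mul_mpolyC; apply: rpredZ; apply: var_homog. Qed.

Lemma red_gen_homog t a : red_gen t a \is (red_deg t).-homog.
Proof.
case: t => [mu|[s t]] /=; apply: rpredB; try apply: rpred_sum => i _.
- exact: mulCX_homog.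
- exact: mulCX_homog.
- exact: (dhomogM (var_homog _) (var_homog _)).
- exact: (dhomogM (var_homog _) (var_homog _)).
Qed.

Lemma red_gen_polyfam t : polyfam (red_gen t).
Proof.
case: t => [mu|[s t]] /=; last exact: polyfamC.
apply: polyfamB; last exact: polyfamC.
apply: polyfam_sum => i; apply: polyfamM; last exact: polyfamC.
exact: polyfam_coord.
Qed.

Lemma meval_quadric_eqn a mu v : (quadric_eqn a mu).@[v] =
  \sum_i a (i, mu) * cval v i
  - \sum_(t : 'I_n * 'I_n | (U_(t.1) + U_(t.2))%MM == mon_of mu) zval v t.1 t.2.
Proof.
rewrite rmorphB !rmorph_sum /=; congr (_ - _).
  by apply: eq_bigr => i _; rewrite rmorphM /= mevalC mevalXU.
rewrite [RHS]big_mkcond; apply: eq_bigr => t _; rewrite rmorphM /= mevalC mevalXU.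
by case: eqP; rewrite ?mul1r ?mul0r.
Qed.

Lemma meval_minor s t v : (minor s t).@[v] =
  zval v s.1 s.2 * zval v t.1 t.2 - zval v s.1 t.2 * zval v t.1 s.2.
Proof. by rewrite rmorphB !rmorphM /= !mevalXU. Qed.

(** At a zero, either [z = 0] and independence gives [c = 0], or [z] has rank one and yields an
    excluded product of nonzero linear forms. *)
Lemma no_split_only_trivial_zero a :
  (forall c, \sum_i c i *: forms a i = 0 -> forall i, c i = 0) ->
  (forall c l l', \sum_i c i *: forms a i = linform l * linform l' ->
     linform l = 0 \/ linform l' = 0) ->
  only_trivial_zero a.
Proof.
move=> indep nsplit v Hv.
have Hq mu : \sum_i a (i, mu) * cval v i
    = \sum_(t : 'I_n * 'I_n | (U_(t.1) + U_(t.2))%MM == mon_of mu) zval v t.1 t.2.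
  by have /eqP := Hv (inl mu); rewrite meval_quadric_eqn subr_eq0 => /eqP.
have Hm i j i' j' : zval v i j * zval v i' j' = zval v i j' * zval v i' j.
  by have /eqP := Hv (inr ((i, j), (i', j'))); rewrite meval_minor subr_eq0 => /eqP.
have [z0|nz0] := classic (forall i j, zval v i j = 0).
  have c0 : \sum_i cval v i *: forms a i = 0.
    rewrite (homog_mons (comb_forms_homog a _)) big1 // => mu _.
    rewrite raddf_sum /= (eq_bigr (fun i => a (i, mu) * cval v i)) => [|i _]; last first.
      by rewrite mcoeffZ mcoeff_forms mulrC.
    by rewrite Hq big1 ?scale0r.
  have {}c0 := indep _ c0.
  move=> j; rewrite -(enum_valK j); case: (enum_val j) => [i|[i i']].
    exact: c0.
  exact: z0.
have [i0 [j0 z0]] : exists i0 j0, zval v i0 j0 != 0.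
  apply: NNPP => nz; apply: nz0 => i j; apply/eqP/negPn/negP => z; apply: nz.
  by exists i, j.
(* By the minors, [z] is the column through a nonzero entry times the row through it divided by that
   entry. *)
pose l i := zval v i j0; pose l' j := zval v i0 j / zval v i0 j0.
have zE i j : zval v i j = l i * l' j.
  by rewrite /l /l' mulrA Hm mulfK.
have /nsplit [] : \sum_i cval v i *: forms a i = linform l * linform l'.
- by apply/comb_forms_linformM => mu; rewrite Hq; apply: eq_bigr => t _; apply: zE.
- by move=> /linform_eq0/(_ i0)/eqP; rewrite (negPf z0).
- by move=> /linform_eq0/(_ j0)/eqP; rewrite /l' divff // oner_eq0.
Qed.

Lemma calI_only_trivial_zero a : calI a -> only_trivial_zero a.
Proof.
move=> [reg irr]; apply: no_split_only_trivial_zero => [c|c l l' E].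
  exact: regular_linear_independent.
have [ll0|ll0] := eqVneq (linform l * linform l') 0.
  by move/eqP: ll0; rewrite mulf_eq0 => /orP[] /eqP; [left|right].
have [|_ [_ /(_ _ _ E) []]] := irr c; first by rewrite E; apply/eqP.
- by move/(homog_not_unit (linform_homog l)).
- by move/(homog_not_unit (linform_homog l')).
Qed.

Lemma only_trivial_zero_comb a (c l l' : 'I_n -> k) : only_trivial_zero a ->
  \sum_i c i *: forms a i = linform l * linform l' ->
  forall i, c i = 0.
Proof.
move=> Ha /comb_forms_linformM E.
pose v (j : 'I_#|cz_var|) :=
  match enum_val j with inl i => c i | inr t => l t.1 * l' t.2 end.
have cE i : cval v i = c i by rewrite /cval /v enum_rankK.
have zE i j : zval v i j = l i * l' j by rewrite /zval /v enum_rankK.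
have v0 : forall j, v j = 0.
  apply: Ha => -[mu|[s t]] /=.
    rewrite meval_quadric_eqn; under eq_bigr do rewrite cE.
    by rewrite E; apply/eqP; rewrite subr_eq0; apply/eqP/eq_bigr => t _; rewrite zE.
  rewrite meval_minor !zE; apply/eqP; rewrite subr_eq0; apply/eqP.
  by rewrite mulrACA [l' _ * _]mulrC mulrACA.
by move=> i; rewrite -cE; apply: v0.
Qed.

Lemma only_trivial_zero_irreducible a : only_trivial_zero a -> span_irreducible (forms a).
Proof.
move=> Ha c g g0; split=> //; have hg : g \is 2.-homog := comb_forms_homog a c.
split=> [|A B E]; first exact: homog_not_unit hg.
have [//|nA] := classic (is_unit A); first by left.
have [|nB] := classic (is_unit B); first by right.
have [l [l' Eg]] := quadric_factor hg g0 E nA nB.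
have c0 := only_trivial_zero_comb Ha Eg; case: g0.
by rewrite /g big1 // => i _; rewrite c0 scale0r.
Qed.

End ReducibilityIdeal.

(** * Openness of the locus *)

Lemma only_trivial_zero_open (k : closedFieldType) n (a : qcoord n -> k) :
  only_trivial_zero a ->
  exists p : {mpoly k[#|qcoord n|]}, coord_eval a p != 0 /\
    forall b, coord_eval b p != 0 -> only_trivial_zero b.
Proof.
move=> Ha; have [p [pa Hp]] := open_no_zero (@red_gen_polyfam k n) (@red_gen_homog k n) Ha.
by exists p.
Qed.

(** The complement is cut out by all polynomials vanishing on it: at each point of [calI], the
    product of the two determinantal polynomials is nonzero, and it vanishes off [calI]. *)
Lemma calI_open (k : closedFieldType) n : (1 <= n)%N -> zariski_open (@calI k n).
Proof.
case: n => // n _.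
exists (fun p => forall b, ~ calI b -> coord_eval b p = 0) => a.
split=> [na p Hp|Ha Ia]; first exact: Hp.
have [reg irr] := Ia.
have [e [he He]] := regular_spans (forms_homog a) reg.
have [p1 [p1a H1]] := spans_regular_open he He.
have [p2 [p2a H2]] := only_trivial_zero_open (calI_only_trivial_zero Ia).
have /eqP : coord_eval a (p1 * p2) = 0.
  apply: Ha => b nb; apply/eqP/negPn/negP; rewrite rmorphM /= mulf_eq0 negb_or.
  move=> /andP[p1b p2b]; apply: nb; split; first exact: H1.
  exact/only_trivial_zero_irreducible/H2.
by rewrite rmorphM /= mulf_eq0 (negPf p1a) (negPf p2a).
Qed.

(** * Existence for n >= 5 *)

(** On the line through [a1] and [a2] the polynomials become univariate and nonzero, as seen at
    [t = 0] and [t = 1]; their product has a nonroot. *)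
Lemma common_nonvanishing (k : closedFieldType) (Q : finType)
    (p1 p2 : {mpoly k[#|Q|]}) (a1 a2 : Q -> k) :
  coord_eval a1 p1 != 0 -> coord_eval a2 p2 != 0 ->
  exists b, coord_eval b p1 != 0 /\ coord_eval b p2 != 0.
Proof.
move=> p1a p2a; pose line (t : k) q := a1 q + t * (a2 q - a1 q).
pose L (p : {mpoly k[#|Q|]}) : {poly k} :=
  mmap (@polyC k) (fun j => (a1 (enum_val j))%:P + (a2 (enum_val j) - a1 (enum_val j))%:P * 'X) p.
have LE p t : (L p).[t] = coord_eval (line t) p.
  rewrite /coord_eval mevalE /L /mmap horner_sum; apply: eq_bigr => m _.
  rewrite hornerM hornerC /mmap1 horner_prod; congr (_ * _); apply: eq_bigr => j _.
  by rewrite horner_exp hornerD hornerMX !hornerC mulrC.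
have L1 : L p1 != 0.
  apply: contraNneq p1a => L0; rewrite -(horner0 0) -L0 LE; apply/eqP/meval_eq => j.
  by rewrite /line mul0r addr0.
have L2 : L p2 != 0.
  apply: contraNneq p2a => L0; rewrite -(horner0 1) -L0 LE; apply/eqP/meval_eq => j.
  by rewrite /line mul1r addrC subrK.
have /closed_nonrootP [t] : L p1 * L p2 != 0 by rewrite mulf_neq0.
by rewrite /root hornerM mulf_eq0 negb_or !LE => /andP[]; exists (line t).
Qed.

Section Examples.
Variables (k : fieldType) (n : nat).
Local Notation P := {mpoly k[n]}.

Definition coords_of (q : 'I_n -> P) : qcoord n -> k :=
  fun t => (q t.1)@_(bmnm (val t.2)).

Lemma forms_coords_of q i : q i \is 2.-homog -> forms (coords_of q) i = q i.
Proof. by move=> hq; rewrite [RHS](homog_mons hq). Qed.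

Lemma Phi_squares (m : 'X_{1..n}) :
  Phi (fun s => 'X_[s]) (fun i => 'X_[U_(i) *+ 2]) m = 'X_[m] :> P.
Proof.
rewrite /Phi mprodXnE -mpolyXD; congr 'X_[_]; apply/mnmP => i.
rewrite mnmDE mnm_sumE (bigD1 i) //= big1 => [|j ne].
  rewrite addn0 !mulmnE mnm1E eqxx mul1n mul2n !mnmE; exact: odd_double_half.
by rewrite !mulmnE mnm1E (negPf ne).
Qed.

Lemma mnm1D_inj (x y z w : 'I_n) : (U_(x) + U_(y) = U_(z) + U_(w))%MM ->
  (x = z /\ y = w) \/ (x = w /\ y = z).
Proof.
move=> E; have Et t : ((x == t) + (y == t) = (z == t) + (w == t))%N.
  by have := congr1 (fun m : 'X_{1..n} => m t) E; rewrite !mnmDE !mnm1E.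
have := Et x; rewrite eqxx; case: (eqVneq z x) => [Ez _|zx].
  left; split; first by rewrite Ez.
  apply/eqP; have := Et w; rewrite Ez eqxx => /eqP; rewrite eqn_add2l.
  by case: (y == w).
case: (eqVneq w x) => [Ew _|wx]; last by case: (y == x).
right; split; first by rewrite Ew.
apply/eqP; have := Et z; rewrite Ew eqxx addnC => /eqP; rewrite eqn_add2r.
by case: (y == z).
Qed.

End Examples.

Lemma squares_regular_open (k : fieldType) n :
  exists (a : qcoord n -> k) (p : {mpoly k[#|qcoord n|]}), coord_eval a p != 0 /\
    forall b, coord_eval b p != 0 -> regular_seq (forms b).
Proof.
pose q i : {mpoly k[n]} := 'X_[U_(i) *+ 2]; exists (coords_of q).
apply: (@spans_regular_open _ _ (fun s => 'X_[s])) => [s|d p hp]; first by rewrite dhomogX.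
exists (fun m => p@_(mon_of m)); rewrite {1}(homog_mons hp); apply: eq_bigr => m _.
congr (_ *: _); rewrite -[LHS]Phi_squares /Phi; congr (_ * _); apply: eq_bigr => i _.
by rewrite forms_coords_of // dhomogX /= mdegMn mdeg1.
Qed.

(* Quadrics through the rational normal curve [t |-> (1 : t : ... : t^(n-1))]:
   no product of two nonzero linear forms vanishes on the curve. *)
Section RationalNormalCurve.
Variables (k : fieldType) (n' : nat).
Local Notation n := n'.+1.
Local Notation P := {mpoly k[n]}.
Hypothesis n_ge5 : (5 <= n)%N.

(** The quadrics are [x_i^2 - x_(i-1) x_(i+1)] for inner [i]; the two end indices carry
    [x_1 x_2 - x_0 x_3] and [x_2 x_3 - x_1 x_4], the latter using [n >= 5]. Lead and tail have equal
    index sums, so the difference vanishes on the curve. *)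
Definition rnc_lead (i : nat) : nat * nat :=
  if i == 0%N then (1, 2)%N else if i == n' then (2, 3)%N else (i, i).

Definition rnc_tail (i : nat) : nat * nat :=
  if i == 0%N then (0, 3)%N else if i == n' then (1, 4)%N else (i.-1, i.+1).

Definition mon2 (t : nat * nat) : 'X_{1..n} := (U_(inord t.1) + U_(inord t.2))%MM.

Definition rnc_quadric (i : 'I_n) : P := 'X_[mon2 (rnc_lead i)] - 'X_[mon2 (rnc_tail i)].

Lemma rnc_bounds (i : 'I_n) :
  [/\ ((rnc_lead i).1 <= n')%N, ((rnc_lead i).2 <= n')%N,
      ((rnc_tail i).1 <= n')%N & ((rnc_tail i).2 <= n')%N].
Proof.
have := ltn_ord i; rewrite /rnc_lead /rnc_tail.
by case: eqP => [_|/eqP i0]; [|case: eqP => [_|/eqP i1]]; split=> /=; lia.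
Qed.

Lemma mon2_inj (t u : nat * nat) : (t.1 <= n')%N -> (t.2 <= n')%N ->
  (u.1 <= n')%N -> (u.2 <= n')%N -> mon2 t = mon2 u ->
  (t.1 = u.1 /\ t.2 = u.2) \/ (t.1 = u.2 /\ t.2 = u.1).
Proof.
move=> t1 t2 u1 u2 /mnm1D_inj.
by case=> -[/(congr1 val) /= E1 /(congr1 val) /= E2]; [left|right]; move: E1 E2; rewrite !inordK.
Qed.

(** Leads are distinct and never tails, so the coefficient at a lead isolates one [c i]: the
    quadrics are independent. *)
Lemma rnc_lead_inj (i j : 'I_n) : mon2 (rnc_lead i) = mon2 (rnc_lead j) -> i = j.
Proof.
have [bi1 bi2 _ _] := rnc_bounds i; have [bj1 bj2 _ _] := rnc_bounds j.
move=> /(mon2_inj bi1 bi2 bj1 bj2) H; apply: val_inj => /=; move: H.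
have := ltn_ord i; have := ltn_ord j; rewrite /rnc_lead.
case: (eqVneq (i : nat) 0%N) => Ei; case: (eqVneq (j : nat) 0%N) => Ej;
case: (eqVneq (i : nat) n') => Ei'; case: (eqVneq (j : nat) n') => Ej' /=; lia.
Qed.

Lemma rnc_lead_tail (i j : 'I_n) : mon2 (rnc_lead i) <> mon2 (rnc_tail j).
Proof.
have [bi1 bi2 _ _] := rnc_bounds i; have [_ _ bj1 bj2] := rnc_bounds j.
move=> /(mon2_inj bi1 bi2 bj1 bj2) H; move: H.
have := ltn_ord i; have := ltn_ord j; rewrite /rnc_lead /rnc_tail.
case: (eqVneq (i : nat) 0%N) => Ei; case: (eqVneq (j : nat) 0%N) => Ej;
case: (eqVneq (i : nat) n') => Ei'; case: (eqVneq (j : nat) n') => Ej' /=; lia.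
Qed.

Lemma rnc_quadric_homog i : rnc_quadric i \is 2.-homog.
Proof. by apply: rpredB; rewrite dhomogX /= mdegD !mdeg1. Qed.

Definition rnc_eval : P -> {poly k} := mmap (@polyC k) (fun i : 'I_n => 'X^i).
HB.instance Definition _ := GRing.RMorphism.copy rnc_eval rnc_eval.

Lemma rnc_eval_mon2 t : (t.1 <= n')%N -> (t.2 <= n')%N ->
  rnc_eval 'X_[mon2 t] = 'X^(t.1 + t.2).
Proof.
move=> t1 t2; rewrite /mon2 mpolyXD rmorphM /= /rnc_eval !mmapX !mmap1U !inordK //.
by rewrite exprD.
Qed.

Lemma rnc_eval_quadric i : rnc_eval (rnc_quadric i) = 0.
Proof.
have [b1 b2 b3 b4] := rnc_bounds i.
rewrite /rnc_quadric rmorphB /= !rnc_eval_mon2 //.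
rewrite [X in 'X^X - _](_ : _ = ((rnc_tail i).1 + (rnc_tail i).2)%N).
  by rewrite subrr.
have := ltn_ord i; rewrite /rnc_lead /rnc_tail.
by case: eqP => [_|/eqP i0]; [|case: eqP => [_|/eqP i1]] => /=; lia.
Qed.

Lemma rnc_eval_linform l : rnc_eval (linform l) = 0 -> linform l = 0.
Proof.
move=> E; rewrite /linform big1 // => i _.
have -> : l i = 0; last by rewrite scale0r.
have := congr1 (fun p : {poly k} => p`_i) E.
rewrite /linform rmorph_sum /= coef_sum coef0 (bigD1 i) //= big1 => [|j ne].
  by rewrite /rnc_eval mmapZ mmapX mmap1U coefCM coefXn eqxx mulr1 addr0.
rewrite /rnc_eval mmapZ mmapX mmap1U coefCM coefXn.
by rewrite (inj_eq val_inj) eq_sym (negPf ne) mulr0.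
Qed.

(** Restricted to the curve, a product of linear forms in the span is zero in the domain [{poly k}],
    so one factor vanishes on the curve and hence is zero. *)
Lemma rnc_only_trivial_zero : only_trivial_zero (coords_of rnc_quadric).
Proof.
have fE i : forms (coords_of rnc_quadric) i = rnc_quadric i.
  exact/forms_coords_of/rnc_quadric_homog.
apply: no_split_only_trivial_zero => [c E i|c l l' E].
  have := congr1 (mcoeff (mon2 (rnc_lead i))) E.
  rewrite mcoeff0 raddf_sum /= (bigD1 i) //= big1 => [|j ne].
    rewrite fE mcoeffZ mcoeffB !mcoeffX eqxx addr0.
    have /negPf -> : mon2 (rnc_tail i) != mon2 (rnc_lead i).
      by apply/eqP => /esym; apply: rnc_lead_tail.
    by rewrite subr0 mulr1.
  rewrite fE mcoeffZ mcoeffB !mcoeffX.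
  have /negPf -> : mon2 (rnc_lead j) != mon2 (rnc_lead i).
    by apply: contraNneq ne => /rnc_lead_inj ->.
  have /negPf -> : mon2 (rnc_tail j) != mon2 (rnc_lead i).
    by apply/eqP => /esym; apply: rnc_lead_tail.
  by rewrite subrr mulr0.
have := congr1 rnc_eval E; rewrite rmorphM rmorph_sum /= big1 => [|i _].
  move=> /esym/eqP; rewrite mulf_eq0 => /orP[] /eqP /rnc_eval_linform; first by left.
  by right.
by rewrite fE -mul_mpolyC rmorphM /= rnc_eval_quadric mulr0.
Qed.

End RationalNormalCurve.

Lemma calI_nonempty (k : closedFieldType) n : (5 <= n)%N -> exists a : qcoord n -> k, calI a.
Proof.
case: n => // n' n5.
have [a1 [p1 [p1a H1]]] := squares_regular_open k n'.+1.
have [p2 [p2a H2]] := only_trivial_zero_open (@rnc_only_trivial_zero k n' n5).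
have [b [p1b p2b]] := common_nonvanishing p1a p2a.
by exists b; split; [apply: H1|apply/only_trivial_zero_irreducible/H2].
Qed.

(** * Emptiness for n <= 4 *)

(* If the reducibility ideal is irrelevant-primary, then modulo the minors the
   degree [D + d] part of [k[c, z]] is spanned by products of [d] quadric
   equations with monomials of degree [D]: this has size [O(d^(r-1))] for [r]
   equations, whereas the chart [z_00 = 1] shows growth at least [d^(3n-2)]. *)
Section Counting.
Variables (k : fieldType) (n' : nat).
Local Notation n := n'.+1.
Variable a : qcoord n -> k.
Local Notation S := {mpoly k[#|cz_var n|]}.

(** Coordinates on the chart [z_ij = y_i w_j] with [y_0 = w_0 = 1]: [n] for the [c_i] and [n - 1]
    each for [y] and [w], hence [3n - 2]. *)
Definition chart_var : finType := ('I_n + ('I_n' + 'I_n'))%type.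
Local Notation U := {mpoly k[#|chart_var|]}.

Definition chart_row (i : 'I_n) : U :=
  if unlift ord0 i is Some j then 'X_(enum_rank (inr (inl j) : chart_var)) else 1.
Definition chart_col (i : 'I_n) : U :=
  if unlift ord0 i is Some j then 'X_(enum_rank (inr (inr j) : chart_var)) else 1.

Definition chart_point (j : 'I_#|cz_var n|) : U :=
  match enum_val j with
  | inl i => 'X_(enum_rank (inl i : chart_var))
  | inr t => chart_row t.1 * chart_col t.2
  end.

Definition chart : S -> U := mmap (@mpolyC _ k) chart_point.
HB.instance Definition _ := GRing.RMorphism.copy chart chart.

Lemma chartX j : chart 'X_j = chart_point j.
Proof. by rewrite /chart mmapX mmap1U. Qed.

Lemma chartZ c p : chart (c *: p) = c *: chart p.
Proof. by rewrite /chart mmapZ mul_mpolyC. Qed.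

Lemma chart_minor s t : chart (minor k s t) = 0.
Proof.
rewrite rmorphB !rmorphM /= !chartX /chart_point !enum_rankK /=.
by apply/eqP; rewrite subr_eq0; apply/eqP; rewrite mulrACA [chart_col _ * _]mulrC mulrACA.
Qed.

Definition chart_eqn (i : 'I_#|mons n 2|) : U := chart (quadric_eqn a (enum_val i)).

Definition eqn_prod d (nu : mons #|mons n 2| d) : U :=
  \prod_i chart_eqn i ^+ mon_of nu i.

Definition chart_span D d (p : U) :=
  exists c : mons #|mons n 2| d * mons #|cz_var n| D -> k,
    p = \sum_t c t *: (eqn_prod t.1 * chart 'X_[mon_of t.2]).

Lemma chart_span_sum D d (I : Type) (s : seq I) (c : I -> k) (F : I -> U) :
  (forall i, chart_span D d (F i)) -> chart_span D d (\sum_(i <- s) c i *: F i).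
Proof.
move=> HF; elim: s => [|i s [c' Hc']].
  by exists (fun=> 0); rewrite big_nil big1 // => t _; rewrite scale0r.
have [c'' Hc''] := HF i; exists (fun t => c i * c'' t + c' t).
rewrite big_cons Hc' Hc'' scaler_sumr -big_split; apply: eq_bigr => t _.
by rewrite scalerDl scalerA.
Qed.

Lemma chart_span_gen D d nu m : chart_span D d (@eqn_prod d nu * chart 'X_[@mon_of _ D m]).
Proof.
exists (fun t => (t == (nu, m))%:R); rewrite (bigD1 (nu, m)) //= eqxx scale1r.
by rewrite big1 ?addr0 // => t /negPf ->; rewrite scale0r.
Qed.

Lemma chart_span_mul D d i p : chart_span D d p -> chart_span D d.+1 (chart_eqn i * p).
Proof.
move=> [c ->]; rewrite mulr_sumr.
rewrite (eq_bigr (fun t =>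
  c t *: (chart_eqn i * (eqn_prod t.1 * chart 'X_[mon_of t.2])))); last first.
  by move=> t _; rewrite -scalerAr.
apply: chart_span_sum => -[nu m] /=.
have [|nu' Enu] := @mon_ofP _ d.+1 (U_(i) + mon_of nu)%MM.
  by rewrite mdegD mdeg1 mdeg_mon_of add1n.
suff -> : chart_eqn i * (eqn_prod nu * chart 'X_[mon_of m]) = eqn_prod nu' * chart 'X_[mon_of m].
  exact: chart_span_gen.
rewrite mulrA; congr (_ * _); rewrite /eqn_prod Enu.
rewrite [RHS](eq_bigr (fun l => chart_eqn l ^+ U_(i)%MM l * chart_eqn l ^+ mon_of nu l)).
  rewrite big_split; congr (_ * _); rewrite (bigD1 i) //= mnm1E eqxx expr1.
  rewrite big1 ?mulr1 // => l /negPf ne; rewrite mnm1E eq_sym ne; exact: expr0.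
by move=> l _; rewrite mnmDE exprD.
Qed.

(** Minors vanish on the chart, so a monomial of degree above [D] becomes a combination of quadric
    equations with cofactors one degree lower. After [d] rounds degree [D] is reached. *)
Lemma chart_span_all D :
  (forall m : 'X_{1..#|cz_var n|}, (D <= mdeg m)%N ->
    exists h : red_index n -> S, 'X_[m] = \sum_t h t * red_gen t a) ->
  forall d p, p \is (D + d).-homog -> chart_span D d (chart p).
Proof.
move=> HD; elim=> [|d IH] p hp.
  rewrite addn0 in hp; rewrite (homog_mons hp) rmorph_sum /=.
  rewrite (eq_bigr (fun m => p@_(mon_of m) *: chart 'X_[mon_of m])) => [|m _]; last exact: chartZ.
  apply: chart_span_sum => m; have [nu _] := @mon_ofP #|mons n 2| 0 0%MM mdeg0.
  suff <- : eqn_prod nu * chart 'X_[mon_of m] = chart 'X_[mon_of m] by apply: chart_span_gen.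
  rewrite /eqn_prod big1 ?mul1r // => i _.
  have /eqP := mdeg_mon_of nu; rewrite mdeg_eq0 => /eqP ->; rewrite mnm0E; exact: expr0.
rewrite (homog_mons hp) rmorph_sum /=.
rewrite (eq_bigr (fun m => p@_(mon_of m) *: chart 'X_[mon_of m])) => [|m _]; last exact: chartZ.
apply: chart_span_sum => m {p hp}.
have [|h Eh] := HD (mon_of m); first by rewrite mdeg_mon_of leq_addr.
have hX : ('X_[mon_of m] : S) \is (D + d.+1).-homog by rewrite dhomogX /= mdeg_mon_of.
rewrite -(pihomog_dE hX) Eh (linear_sum (pihomog mdeg (D + d.+1) : {linear S -> S})) /=.
rewrite rmorph_sum big_sumType /= [X in _ + X]big1 => [|st _]; last first.
  rewrite (pihomogM _ _ (red_gen_homog (inr st) a)); case: ifP => _; last exact: rmorph0.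
  by rewrite rmorphM /= chart_minor mulr0.
rewrite addr0 (eq_bigr (fun mu => 1 *: (chart_eqn (enum_rank mu)
  * chart (pihomog mdeg (D + d) (h (inl mu)))))).
  by apply: chart_span_sum => mu; apply: chart_span_mul; apply: IH; apply: pihomogP.
move=> mu _; rewrite (pihomogM _ _ (red_gen_homog (inl mu) a)) /= addnS subn1 /= scale1r.
by rewrite rmorphM /= mulrC /chart_eqn enum_rankK.
Qed.

Definition chart_lift (t : chart_var) : cz_var n :=
  match t with
  | inl i => inl i
  | inr (inl j) => inr (lift ord0 j, ord0)
  | inr (inr j) => inr (ord0, lift ord0 j)
  end.

Lemma chart_chart_lift t : chart 'X_(enum_rank (chart_lift t)) = 'X_(enum_rank t).
Proof.
rewrite chartX /chart_point enum_rankK; case: t => [i|[j|j]] //=.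
  by rewrite /chart_row /chart_col liftK unlift_none mulr1.
by rewrite /chart_row /chart_col liftK unlift_none mul1r.
Qed.

(** Powers of [z_00], which the chart sends to 1, pad a lifted monomial to the exact degree. *)
Lemma chart_monomial (m : 'X_{1..#|chart_var|}) d : (mdeg m <= d)%N ->
  exists m' : 'X_{1..#|cz_var n|}, mdeg m' = d /\ chart 'X_[m'] = 'X_[m].
Proof.
move=> le_d; pose o : 'I_#|cz_var n| := enum_rank (inr (ord0, ord0) : cz_var n).
pose lft (j : 'I_#|chart_var|) : 'I_#|cz_var n| := enum_rank (chart_lift (enum_val j)).
exists (\sum_j U_(lft j) *+ m j + U_(o) *+ (d - mdeg m))%MM; split.
  rewrite mdegD mdegMn mdeg1 mul1n mdeg_sum (eq_bigr (fun j => m j)) => [|j _].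
    by rewrite -mdegE subnKC.
  by rewrite mdegMn mdeg1 mul1n.
rewrite mpolyXD rmorphM /= -mpolyXn rmorphXn /= chartX /chart_point enum_rankK /=.
rewrite /chart_row /chart_col unlift_none mulr1 expr1n mulr1.
rewrite -mprodXnE rmorph_prod /= mpolyXE_id; apply: eq_bigr => j _.
by rewrite rmorphXn /= chart_chart_lift enum_valK.
Qed.

(** The [q^(3n-2)] chart monomials with all exponents below [q] are independent and lie in the span
    of the listed products. *)
Lemma chart_count D d q :
  (forall p, p \is (D + d).-homog -> chart_span D d (chart p)) ->
  (#|chart_var| * q <= D + d)%N ->
  (q ^ #|chart_var| <= #|mons #|mons n 2| d| * #|mons #|cz_var n| D|)%N.
Proof.
move=> span_d le_d; rewrite leqNgt; apply/negP => lt_q.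
pose J : finType := {ffun 'I_#|chart_var| -> 'I_q}.
pose mJ (phi : J) : 'X_{1..#|chart_var|} := [multinom phi j : nat | j < #|chart_var|].
have mJ_inj : injective mJ.
  move=> phi psi /mnmP E; apply/ffunP => j; apply: val_inj.
  by have := E j; rewrite !mnmE.
have /fin_all_exists [c Hc] (phi : J) : chart_span D d 'X_[mJ phi].
  have [|m [dm <-]] := @chart_monomial (mJ phi) (D + d).
    apply: leq_trans le_d; rewrite mdegE -[X in (X * q)%N]card_ord -sum_nat_const.
    by apply: leq_sum => j _; rewrite mnmE ltnW.
  by apply: span_d; rewrite dhomogX /= dm.
have [|u [[phi u0] Hu]] := linear_dependence c.
  by rewrite card_ffun !card_ord card_prod.
have : \sum_psi u psi *: ('X_[mJ psi] : U) = 0.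
  rewrite (eq_bigr (fun psi => \sum_t (u psi * c psi t) *: (eqn_prod t.1 * chart 'X_[mon_of t.2]))).
    rewrite exchange_big big1 // => t _; by rewrite -scaler_suml Hu scale0r.
  by move=> psi _; rewrite {1}Hc scaler_sumr; apply: eq_bigr => t _; rewrite scalerA.
move=> /(congr1 (mcoeff (mJ phi))); rewrite mcoeff0 raddf_sum /= (bigD1 phi) //=.
rewrite mcoeffZ mcoeffX eqxx mulr1 big1 ?addr0 => [/eqP|psi ne]; first exact/negP.
by rewrite mcoeffZ mcoeffX (inj_eq mJ_inj) (negPf ne) mulr0.
Qed.

End Counting.

Lemma card_mons_le r d : (#|mons r.+1 d| <= d.+1 ^ r)%N.
Proof.
rewrite card_mons; elim: r => [|r IH]; first by rewrite addn0 binn.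
have E : (r.+1 * 'C(d + r.+1, d) = (d + r.+1) * 'C(d + r, d))%N.
  by have := mul_bin_down (d + r.+1) d; rewrite addKn addnS => <-.
rewrite -(leq_pmul2l (ltn0Sn r)) E expnS mulnA; apply: leq_mul IH.
by rewrite mulSn addnS -addSn leq_add2l leq_pmulr.
Qed.

(** For [n] at most 4, the number [r + 1 = n(n+1)/2] of quadric equations is at most [f = 3n - 2],
    so the products grow too slowly to span. *)
Lemma calI_empty (k : closedFieldType) n : (1 <= n <= 4)%N ->
  forall a : qcoord n -> k, ~ calI a.
Proof.
case: n => // n' n4 a /calI_only_trivial_zero Ha.
have [D HD] := gen_ideal_nilvars (fun t => red_gen_homog t a) Ha.
have Hspan := chart_span_all HD.
set f := #|chart_var n'|; have Ef : f = (n'.+1 + (n' + n'))%N by rewrite /f !card_sum !card_ord.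
have [r Er] : exists r, #|mons n'.+1 2| = r.+1.
  by rewrite card_mons; case: n' n4 {f Ef a Ha D HD Hspan} => [|[|[|[|]]]] //= _; eexists.
have le_rf : (r < f)%N.
  rewrite -Er card_mons Ef; by case: n' n4 {f Ef a Ha D HD Hspan Er} => [|[|[|[|]]]].
(* With [d = f q] there are at most [((f + 1) q)^r M] products. As [q] exceeds [M (f + 1)^r], this
   is less than [q^(r+1)], which is at most [q^f]. *)
pose M := #|mons #|cz_var n'.+1| D|; pose q := (M * f.+1 ^ r).+1.
have := chart_count (Hspan (f * q)%N) (leq_addl _ _); apply/negP; rewrite -ltnNge Er.
apply: (@leq_ltn_trans ((f.+1 * q) ^ r * M)).
  rewrite leq_mul2r; apply/orP; right; apply: leq_trans (card_mons_le _ _) _.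
  by case: (r) => // r0; rewrite leq_exp2r // mulSn addnC -addn1 leq_add2l.
rewrite expnMn mulnAC mulnC [(_ * M)%N]mulnC; apply: (@leq_trans (q ^ r.+1)).
  by rewrite expnS mulnC ltn_pmul2r ?expn_gt0.
exact: leq_pexp2l.
Qed.

Theorem theorem5p2 (k : closedFieldType) (hchar : (2 \notin [pchar k])%N)
    (n : nat) (hn : (1 <= n)%N) :
  zariski_open (@calI k n)
  /\ ((n <= 4)%N -> forall a : qcoord n -> k, ~ calI a)
  /\ ((5 <= n)%N -> exists a : qcoord n -> k, calI a).
Proof.
split; first exact: calI_open.
split=> [n4 a|]; first by apply: calI_empty; rewrite hn n4.
exact: calI_nonempty.
Qed.
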